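(* Let $G$ be a finite subgroup of $\mathrm{SU}_2$ that is not isomorphic to a cyclic group of odd order, and let $V=\mathbb{C}^2$. Let $A$ be the adjacency matrix of the representation graph $\mathcal{R}_V(G)$ (the affine Dynkin diagram corresponding to $G$) and $\mathring{A}$ the adjacency matrix of the corresponding finite Dynkin diagram. Let $\widehat{\Xi}$ (resp. $\Xi$) be the set of exponents, taken with multiplicity, and $\widehat{h}$ (resp. $h$) the Coxeter number corresponding to the affine (resp. finite) Dynkin diagram, as listed in the context. Then the Poincaré series $m^0(t)=\sum_{k\ge0}\dim\bigl((V^{\otimes k})^G\bigr)t^k$ for the $G$-invariants $T(V)^G$ in $T(V)=\bigoplus_{k\ge 0}V^{\otimes k}$ is $$ m^0(t)=\frac{\det(I-t\mathring{A})}{\det(I-tA)}=\frac{\det(I-t\mathring{A})}{\prod_{g\in\Gamma}\bigl(1-\chi_V(g)t\bigr)}=\frac{\prod_{m\in\Xi}\left(1-2\cos\left(\frac{\pi m}{h}\right)t\right)}{\prod_{\widehat{m}\in\widehat{\Xi}}\left(1-2\cos\left(\frac{\pi\widehat{m}}{\widehat{h}}\right)t\right)}, $$ where $\Gamma$ is a set of conjugacy class representatives of $G$ and $\chi_V$ is the character of $V$.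
   Context: $\mathrm{SU}_2$ is the group of $2\times 2$ complex special unitary matrices, and $V=\mathbb{C}^2$ is the space of $2\times1$ column vectors on which $G\subset\mathrm{SU}_2$ acts by matrix multiplication. $V^{\otimes 0}=\mathbb{C}$ is the trivial module. $\Lambda(G)$ indexes the irreducible complex $G$-modules $G^\lambda$, with $0\in\Lambda(G)$ the index of the trivial module. The representation graph $\mathcal{R}_V(G)$ has nodes indexed by $\Lambda(G)$ and adjacency matrix $A=(a_{\mu,\lambda})$, where $a_{\mu,\lambda}$ is the multiplicity of $G^\lambda$ in $G^\mu\otimes V$. By the McKay correspondence $\mathcal{R}_V(G)$ is an affine Dynkin diagram with affine node $0$, as follows: cyclic group $\mathbf{C}_n$ of order $n$: $\widehat{\mathsf{A}}_{n-1}$; binary dihedral group $\mathbf{D}_n$ of order $4n$ ($n\ge 2$): $\widehat{\mathsf{D}}_{n+2}$; binary tetrahedral group (order 24): $\widehat{\mathsf{E}}_6$; binary octahedral group (order 48): $\widehat{\mathsf{E}}_7$; binary icosahedral group (order 120): $\widehat{\mathsf{E}}_8$. The corresponding finite Dynkin diagram ($\mathsf{A}_{n-1}$, $\mathsf{D}_{n+2}$, $\mathsf{E}_6$, $\mathsf{E}_7$, $\mathsf{E}_8$ respectively) is obtained by removing node $0$, so $\mathring{A}$ is $A$ with the row and column indexed by $0$ deleted. $I$ denotes an identity matrix of appropriate size. The identities hold for formal power series in $t$. Exponents (listed with multiplicity) and Coxeter numbers. Finite diagrams: - $\mathsf{A}_{n-1}$: exponents $1,2,\dots,n-1$; Coxeter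 number $h=n$. - $\mathsf{D}_{n+2}$: exponents $1,3,5,\dots,2n+1$ (all odd numbers in this range) together with one additional $n+1$; $h=2n+2$. - $\mathsf{E}_6$: $1,4,5,7,8,11$; $h=12$. - $\mathsf{E}_7$: $1,5,7,9,11,13,17$; $h=18$. - $\mathsf{E}_8$: $1,7,11,13,17,19,23,29$; $h=30$. Affine diagrams: - $\widehat{\mathsf{A}}_{2\ell+1}$: $0,1,1,2,2,\dots,\ell,\ell,\ell+1$ (each of $1,\dots,\ell$ twice, $0$ and $\ell+1$ once); $\widehat{h}=\ell+1$. - $\widehat{\mathsf{D}}_{2\ell+1}$: $0,2,\dots,2\ell-2,2\ell-1,2\ell-1,2\ell,\dots,2(2\ell-1)$ (every even number from $0$ to $2(2\ell-1)$ once, and $2\ell-1$ twice); $\widehat{h}=2(2\ell-1)$. - $\widehat{\mathsf{D}}_{2\ell}$: $0,1,\dots,\ell-1,\ell-1,\ell-1,\ell,\dots,2\ell-2$ (every integer from $0$ to $2\ell-2$ once, except $\ell-1$, which occurs three times); $\widehat{h}=2\ell-2$. - $\widehat{\mathsf{E}}_6$: $0,2,2,3,4,4,6$; $\widehat{h}=6$. - $\widehat{\mathsf{E}}_7$: $0,3,4,6,6,8,9,12$; $\widehat{h}=12$. - $\widehat{\mathsf{E}}_8$: $0,6,10,12,15,18,20,24,30$; $\widehat{h}=30$. *)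

(* Defs.v *)
From mathcomp Require Import all_boot all_order all_algebra all_fingroup all_solvable.
From mathcomp Require Import all_field all_character.
From mathcomp Require Import reals trigo.
From mathcomp.real_closed Require Import complex.

Set Implicit Arguments.
Unset Strict Implicit.
Unset Printing Implicit Defensive.

Import Order.TTheory GRing.Theory Num.Theory.
Local Open Scope ring_scope.
Local Open Scope complex_scope.

(* Formal power series over F are coefficient functions nat -> F.  The
   quotient P / Q of two polynomials, for Q`_0 != 0, is computed by
   solving (P / Q) * Q = P coefficient by coefficient. *)
Section PowerSeriesQuotient.
Variable F : fieldType.
Implicit Types (P Q : {poly F}) (f : nat -> F).

Fixpoint fps_div_seq P Q n : seq F :=
  if n is m.+1 then
    let s := fps_div_seq P Q m in
    rcons s ((P`_m - \sum_(i < m) s`_i * Q`_(m - i)) / Q`_0)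
  else [::].

Definition fps_div P Q : nat -> F := fun n => (fps_div_seq P Q n.+1)`_n.

Lemma size_fps_div_seq P Q n : size (fps_div_seq P Q n) = n.
Proof. by elim: n => //= n IHn; rewrite size_rcons IHn. Qed.

Lemma nth_fps_div_seq P Q n i :
  (i < n)%N -> (fps_div_seq P Q n)`_i = fps_div P Q i.
Proof.
elim: n => // n IHn; rewrite ltnS leq_eqVlt => /predU1P[-> // | lt_in].
by rewrite /= nth_rcons size_fps_div_seq lt_in IHn.
Qed.

Lemma fps_divE P Q n :
  fps_div P Q n = (P`_n - \sum_(i < n) fps_div P Q i * Q`_(n - i)) / Q`_0.
Proof.
rewrite {1}/fps_div /= nth_rcons size_fps_div_seq ltnn eqxx.
by congr ((_ - _) / _); apply: eq_bigr => i _; rewrite nth_fps_div_seq.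
Qed.

Lemma fps_divP P Q f : Q`_0 != 0 ->
  f =1 fps_div P Q <->
  (forall n, \sum_(i < n.+1) f i * Q`_(n - i) = P`_n).
Proof.
move=> nzQ; split=> [eq_f n | defP n].
  rewrite big_ord_recr /= subnn eq_f fps_divE divfK //.
  by rewrite (eq_bigr (fun i : 'I_n => fps_div P Q i * Q`_(n - i))) ?subrKC //
     => i _; rewrite eq_f.
elim/ltn_ind: n => n IHn; rewrite fps_divE.
rewrite -(eq_bigr _ (fun (i : 'I_n) _ => congr1 ( *%R^~ Q`_(n - i)) (IHn i (ltn_ord i)))).
by rewrite -defP big_ord_recr /= subnn addrAC subrr add0r mulfK.
Qed.

End PowerSeriesQuotient.

(* A homomorphism rho : G -> GL_n(F) stands for the left module F^n of column
   vectors v, with g.v = rho(g) *m v.  The library's submodules are those of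
   row vectors, acted on from the right; irreducibility of rho, similarity and
   multiplicities do not depend on this choice. *)
Section Modules.
Variables (F : closedFieldType) (gT : finGroupType) (G : {group gT}).

Lemma triv_mx_repr : mx_repr G (fun _ : gT => 1%:M : 'M[F]_1).
Proof. by split=> [|g h _ _] //; rewrite mulmx1. Qed.

Definition triv_repr := MxRepresentation triv_mx_repr.

Fixpoint tensor_power n (rV : mx_representation F G n) k : representation F G :=
  if k is k'.+1 then Representation (prod_repr (tensor_power rV k') rV)
  else Representation triv_repr.

Definition invariants n (rV : mx_representation F G n) : {vspace 'cV[F]_n} :=
  (\bigcap_(g in G) fixedSpace (linfun (mulmx (rV g))))%VS.

Definition poincare_series n (rV : mx_representation F G n) (k : nat) : F :=
  (\dim (invariants (tensor_power rV k)))%:R.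

(* The index set of the irreducible G-modules; irr_repr l is the module with
   index l : irr_index, and [1 irr_index] is the index of the trivial one. *)
Definition irr_index : irrType F G := DecSocleType (regular_repr F G).

(* The components of rV are pairwise non-isomorphic, so that the sum has at
   most one term. *)
Definition irr_mult n (rV : mx_representation F G n) (l : irr_index) : nat :=
  \sum_(W : DecSocleType rV | irr_comp irr_index (socle_repr W) == l)
     socle_mult W.

Definition repr_graph n (rV : mx_representation F G n) : 'M[F]_#|irr_index| :=
  \matrix_(i, j) (irr_mult (prod_repr (irr_repr (enum_val i)) rV)
                           (enum_val j))%:R.

Definition affine_node : 'I_#|irr_index| := enum_rank [1 irr_index]%irr.

Definition finite_graph n (rV : mx_representation F G n) :
    'M[F]_(#|irr_index|.-1) :=
  row' affine_node (col' affine_node (repr_graph rV)).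

End Modules.

(* det (I - t M), with t = 'X *)
Definition det1X (F : fieldType) n (M : 'M[F]_n) : {poly F} :=
  \det (1%:M - 'X *: map_mx polyC M).

(* Finite subgroups of SU_2 are given as finite groups G with an injective
   homomorphism into SU_2. *)
Definition SU2_subgroup (R : realType) (gT : finGroupType) (G : {group gT})
    (rV : mx_representation R[i] G 2) : Prop :=
  mx_faithful rV /\
  forall g, g \in G -> rV g \is unitarymx /\ \det (rV g) = 1.

(* The subscript is the rank of the finite diagram. *)
Inductive dynkin : Type :=
  DynkinA of nat | DynkinD of nat | DynkinE6 | DynkinE7 | DynkinE8.

(* G is the inverse image in SU_2 of a subgroup of SU_2 / {1, -1} = SO_3
   that is isomorphic to H. *)
Definition binary_cover (R : realType) (gT : finGroupType) (G : {group gT})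
    (rV : mx_representation R[i] G 2) (hT : finGroupType) (H : {group hT}) :
    Prop :=
  exists z, [/\ z \in G, rV z = - 1%:M & (G / <[z]>)%g \isog H].

(* The groups C_n = C_(r+1), D_n = D_(r-2) (of order 4n, n >= 2), T, O and I.
   Here 'D_m is the dihedral group of order m; the rotation groups of the
   tetrahedron, the octahedron and the icosahedron are Alt_4, Sym_4, Alt_5. *)
Definition mckay_type (R : realType) (gT : finGroupType) (G : {group gT})
    (rV : mx_representation R[i] G 2) (X : dynkin) : Prop :=
  match X with
  | DynkinA r => cyclic G /\ #|G| = r.+1
  | DynkinD r => (4 <= r)%N /\ binary_cover rV 'D_(2 * (r - 2))%N%G
  | DynkinE6 => binary_cover rV 'Alt_('I_4)%G
  | DynkinE7 => binary_cover rV 'Sym_('I_4)%G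
  | DynkinE8 => binary_cover rV 'Alt_('I_5)%G
  end.

Definition fin_exponents (X : dynkin) : seq nat :=
  match X with
  | DynkinA r => iota 1 r
  | DynkinD r => rcons [seq (2 * i).+1 | i <- iota 0 r.-1] r.-1
  | DynkinE6 => [:: 1; 4; 5; 7; 8; 11]
  | DynkinE7 => [:: 1; 5; 7; 9; 11; 13; 17]
  | DynkinE8 => [:: 1; 7; 11; 13; 17; 19; 23; 29]
  end%N.

Definition fin_coxeter (X : dynkin) : nat :=
  match X with
  | DynkinA r => r.+1
  | DynkinD r => 2 * r.-1
  | DynkinE6 => 12
  | DynkinE7 => 18
  | DynkinE8 => 30
  end%N.

(* For DynkinA r the values are meaningful only for odd r (r = 2l+1);
   even r correspond to the cyclic groups of odd order. *)
Definition aff_exponents (X : dynkin) : seq nat :=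
  match X with
  | DynkinA r => let l := r./2 in 0 :: iota 1 l ++ iota 1 l ++ [:: l.+1]
  | DynkinD r =>
      let l := r./2 in
      if odd r then [seq 2 * i | i <- iota 0 (2 * l)] ++ [:: 2 * l - 1; 2 * l - 1]
      else iota 0 (2 * l - 1) ++ [:: l - 1; l - 1]
  | DynkinE6 => [:: 0; 2; 2; 3; 4; 4; 6]
  | DynkinE7 => [:: 0; 3; 4; 6; 6; 8; 9; 12]
  | DynkinE8 => [:: 0; 6; 10; 12; 15; 18; 20; 24; 30]
  end%N.

Definition aff_coxeter (X : dynkin) : nat :=
  match X with
  | DynkinA r => r./2.+1
  | DynkinD r => let l := r./2 in
      if odd r then 2 * (2 * l - 1) else 2 * l - 2
  | DynkinE6 => 6
  | DynkinE7 => 12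
  | DynkinE8 => 30
  end%N.

Definition exponent_poly (R : realType) (ms : seq nat) (h : nat) : {poly R[i]} :=
  \prod_(m <- ms) (1 - (2 * cos (pi * m%:R / h%:R) : R)%:C *: 'X).

(* Main.v *)
Require Import Defs.
From mathcomp Require Import all_boot all_order all_algebra all_fingroup all_solvable.
From mathcomp Require Import all_field all_character.
From mathcomp Require Import reals trigo.
From mathcomp.real_closed Require Import complex.
From mathcomp Require Import ring zify.

Set Implicit Arguments.
Unset Strict Implicit.
Unset Printing Implicit Defensive.

Import Order.TTheory GroupScope GRing.Theory Num.Theory.
Local Open Scope ring_scope.

(* Let chi be the character of V.  The character table X satisfies A X = X D with
   D the diagonal of the values of chi on the classes, so det (I - tA) is the
   product of the 1 - chi(g) t, and Cramer's rule turns the quotient of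
   determinants into the mean of the 1 / (1 - chi(g) t) over G, which is m^0(t)
   because the dimension of the invariants is the mean of the character.

   To compute this mean, put t = 1 / (z + 1/z).  Each noncentral element of G lies
   in exactly one of the cyclic groups C = C_G(x), and the sum over C runs over
   the roots of unity of order #|C|.  If L lists the orders of the stabilisers of
   the orbits of poles of G / {1, -1}, of order N, this gives
     m^0(t) = (z + 1/z) (sum_(n in L) E_n - (#|L| - 2) E_1) / 2,
     E_n = (z^2n + 1) / ((z^2n - 1) (z - 1/z)).
   Counting elements gives sum_(n in L) (1 - 1/n) = 2 (1 - 1/N), which leaves the
   types A, D, E6, E7, E8.  The products over exponents are evaluated by
     prod_(0 < j < n) (z + 1/z - 2 cos (pi j / n)) = (z^n - z^-n) / (z - 1/z),
     prod_(j < n) (z + 1/z - 2 cos (pi (2j + 1) / 2n)) = z^n + z^-n.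
   The isomorphism types come from the actions of G on the four axes of order 3
   (E6, E7) and on the five quaternion subgroups of order 8 (E8). *)

(** Write J z = z + 1/z. An element with eigenvalues e and 1/e has trace J e, and at t = 1 / J z the
    factor 1 - chi(g) t becomes (J z - J e) / J z with J z - J e = (z - e)(z - 1/e) / z. The factor
    of an exponent m has the same form with e = exp(i pi m / h), so group elements and exponents are
    both handled through roots of unity. The last equality of series is cross-multiplied into one
    between polynomials, which is tested at the infinitely many points 1 / J z with z neither 0 nor
    a root of unity. The list L must serve three purposes: the count of elements that bounds it, the
    evaluation of the series, and the number of axes of each order, from which the permutation
    actions are built. This is why [pole_list] states its identity for an arbitrary function [phi]
    of the order with values in any commutative monoid. The excluded groups are those of odd order.
    Even order is what puts -1 in G; every axis then has even order 2n and contributes through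
    E_n. *)

Lemma dim_limg_mulmx (F : fieldType) m n (P : 'M[F]_(m, n)) :
  \dim (limg (linfun (mulmx P : 'cV_n -> 'cV_m))) = \rank P.
Proof.
pose C := linfun (mulmx (col_base P) : 'cV_(\rank P) -> 'cV_m).
have ->: limg (linfun (mulmx P : 'cV_n -> 'cV_m)) = limg C.
  apply/vspaceP => v; apply/memv_imgP/memv_imgP => [] [u _ ->].
    by exists (row_base P *m u); rewrite ?memvf // !lfunE /= mulmxA mulmx_base.
  exists (pinvmx (row_base P) *m u); rewrite ?memvf // !lfunE /=.
  transitivity (col_base P *m row_base P *m (pinvmx (row_base P) *m u)).
    by rewrite -mulmxA (mulmxA (row_base P)) mulmxVp ?row_base_free // mul1mx.
  by rewrite mulmx_base.
have kerC: lker C == 0%VS.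
  rewrite -subv0; apply/subvP => u; rewrite memv_ker memv0 lfunE /= => /eqP Cu0.
  by apply/eqP/(row_full_inj (col_base_full P)); rewrite Cu0 mulmx0.
by rewrite limg_dim_eq ?(eqP kerC) ?capv0 // dimvf dim_matrix mulr1.
Qed.

(** * Characters and the representation graph *)

Section CharactersOverClosedField.
Variables (F : closedFieldType) (gT : finGroupType) (G : {group gT}).
Hypothesis F0 : [pchar F] =i pred0.
Local Notation sG := (irr_index F G).
Local Notation nG := (#|G|%:R : F).

Let F'G : [pchar F]^'.-group G.
Proof. by rewrite /pgroup (eq_pnat _ (eq_negn F0)); apply/pnatP. Qed.

Let natF_eq0 n : (n%:R == 0 :> F) = (n == 0%N).
Proof. by have /pcharf0P -> := F0. Qed.

Lemma card_irr_index : #|sG| = #|classes G|.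
Proof. by apply: card_irr_pchar => //; apply: group_closure_closed_field. Qed.

(** By Maschke the module is the sum of its socle components, which are grouped here by isomorphism
    type. *)
Lemma mxtrace_irr_mult n (rV : mx_representation F G n) g : g \in G ->
  \tr (rV g) = \sum_(l : sG) (irr_mult rV l)%:R * \tr (irr_repr l g).
Proof.
move=> Gg; pose sV := DecSocleType rV.
have soc1: (Socle sV :=: 1%:M)%MS.
  by rewrite reducible_Socle1 //; apply: mx_Maschke_pchar.
rewrite -(mxtrace_submod1 (Socle_module sV) soc1) // mxtrace_Socle //.
rewrite (partition_big (fun W : sV => irr_comp sG (socle_repr W)) xpredT) //=.
apply: eq_bigr => l _; rewrite natr_sum mulr_suml; apply: eq_bigr => W /eqP <-.
rewrite mulr_natl; congr (_ *+ _); apply: mxtrace_rsim => //.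
by apply: rsim_irr_comp_pchar => //; apply: socle_irr.
Qed.

Lemma mxtrace_conj n (rV : mx_representation F G n) g h :
  g \in G -> h \in G -> \tr (rV (g ^ h)%g) = \tr (rV g).
Proof.
move=> Gg Gh; rewrite conjgE !repr_mxM ?groupM ?groupV // mulmxA mxtrace_mulC.
by rewrite mulmxA -repr_mxM ?groupV // mulgV repr_mx1 mul1mx.
Qed.

(** The relation extends linearly to the group algebra. Evaluated at the Wedderburn idempotent of
    [l], which acts as 1 on [l] and as 0 on every other irreducible, it leaves [c l] times a degree,
    nonzero in characteristic 0. *)
Lemma irr_characters_free (c : sG -> F) :
  (forall g, g \in G -> \sum_l c l * \tr (irr_repr l g) = 0) ->
  forall l, c l = 0.
Proof.
move=> c0 l.
have [a def_e]: exists a, Wedderburn_id l = \sum_(x in G) a x *: regular_repr F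
  G x.
  apply/envelop_mxP; have := Wedderburn_id_mem l; rewrite genmxE.
  by move/submx_trans; apply; apply: submxMl.
have: \sum_k c k * \tr (gring_op (irr_repr k) (Wedderburn_id l)) = 0.
  transitivity (\sum_(x in G) a x * \sum_k c k * \tr (irr_repr k x)).
    under eq_bigr => k _.
      rewrite def_e linear_sum raddf_sum mulr_sumr /=.
      under eq_bigr => x Gx do rewrite linearZ /= mxtraceZ gring_opG // mulrCA.
      over.
    by rewrite exchange_big; apply: eq_bigr => x _; rewrite mulr_sumr.
  by rewrite big1 // => x Gx; rewrite c0 ?mulr0.
rewrite (bigD1 l) //= big1 ?addr0 => [|k /negPf ne_kl]; last first.
  rewrite (irr_repr'_op0_pchar _ _ (Wedderburn_id_mem l)) ?mxtrace0 ?mulr0 //.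
  by rewrite eq_sym ne_kl.
rewrite op_Wedderburn_id_pchar // mxtrace1 => /eqP; rewrite mulf_eq0.
by case/predU1P => //; rewrite natF_eq0 (negPf (lt0n_neq0 (irr_degree_gt0 l))).
Qed.

(** The sum of all group elements is fixed by G, so it lies in the Wedderburn component of the
    trivial module and every other irreducible kills it. *)
Lemma sum_irr_character (l : sG) :
  \sum_(g in G) \tr (irr_repr l g) = nG *+ (l == [1 sG]%irr).
Proof.
have [-> | ne_l1] := eqVneq.
  under eq_bigr => g Gg do rewrite irr1_repr // mxtrace1 degree_irr1.
  by rewrite sumr_const mulr1n.
pose A := gset_mx F G G.
have A_R1 : (A \in Wedderburn_subring ([1 sG]%irr))%MS.
  have RA: (A \in group_ring F G)%MS.
    by apply/envelop_mxP; exists (fun=> 1); apply: eq_bigr => x;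
      rewrite scale1r.
  by rewrite genmxE -(gring_rowK RA) mem_gring_mx irr1_rfix rfix_regular.
have := irr_repr'_op0_pchar F'G _ A_R1 => /(_ l).
rewrite eq_sym => /(_ ne_l1) A0.
transitivity (\tr (gring_op (irr_repr l) A));
  last by rewrite A0 mxtrace0 mulr0n.
rewrite /A /gset_mx linear_sum raddf_sum /=.
by apply: eq_bigr => g Gg; rewrite gring_opG.
Qed.

Lemma mxtrace_idempotent n (P : 'M[F]_n) : P *m P = P -> \tr P = (\rank P)%:R.
Proof.
move=> PP; rewrite -{1}(mulmx_base P) mxtrace_mulC.
suff ->: row_base P *m col_base P = 1%:M by rewrite mxtrace1.
apply: (row_free_inj (row_base_free P));
  apply: (row_full_inj (col_base_full P)).
transitivity (col_base P *m row_base P *m (col_base P *m row_base P)).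
  by rewrite !mulmxA.
by rewrite mul1mx mulmx_base PP.
Qed.

(** The mean [P] of the matrices [rV g] is a projector onto the invariants, and the trace of a
    projector is its rank. *)
Lemma dim_invariants n (rV : mx_representation F G n) :
  (\dim (invariants rV))%:R = nG^-1 * \sum_(g in G) \tr (rV g) :> F.
Proof.
have nz_nG: nG != 0 by rewrite natF_eq0 -lt0n cardG_gt0.
pose P := nG^-1 *: \sum_(g in G) rV g.
have gP g : g \in G -> rV g *m P = P.
  move=> Gg; rewrite -scalemxAr mulmx_sumr; congr (_ *: _).
  rewrite [RHS](reindex_inj (mulgI g)) /=; apply: eq_big => [h | h Gh].
    by rewrite groupMl.
  by rewrite repr_mxM.
have fixP (v : 'cV_n): (forall g, g \in G -> rV g *m v = v) -> P *m v = v.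
  move=> fv; rewrite -scalemxAl mulmx_suml (eq_bigr (fun=> v)) //.
  by rewrite sumr_const -scaler_nat scalerA mulVf ?scale1r.
have PP : P *m P = P.
  rewrite {1}/P -scalemxAl mulmx_suml (eq_bigr (fun=> P)) //.
  by rewrite sumr_const -scaler_nat scalerA mulVf ?scale1r.
have ->: nG^-1 * \sum_(g in G) \tr (rV g) = \tr P.
  by rewrite mxtraceZ raddf_sum.
rewrite mxtrace_idempotent //; congr (_%:R).
have ->: invariants rV = limg (linfun (mulmx P : 'cV_n -> 'cV_n)).
  apply/vspaceP => v; apply/idP/memv_imgP => [Iv | [u _ ->]].
    exists v; rewrite ?memvf // lfunE /= fixP // => g Gg.
    have /fixedSpaceP : v \in fixedSpace (linfun (mulmx (rV g))).
      by apply: subvP v Iv; rewrite /invariants (bigcapv_inf g).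
    by rewrite lfunE.
  rewrite /invariants memvE; apply/subv_bigcapP => g Gg.
  by rewrite -memvE; apply/fixedSpaceP; rewrite !lfunE /= mulmxA gP.
exact: dim_limg_mulmx.
Qed.

Lemma mxtrace_tensor_power n (rV : mx_representation F G n) k g : g \in G ->
  \tr (tensor_power rV k g) = \tr (rV g) ^+ k.
Proof.
move=> Gg; elim: k => [|k IHk] /=; first by rewrite mxtrace1 expr0.
by rewrite exprSr -IHk mxtrace_prod.
Qed.

Lemma poincare_seriesE n (rV : mx_representation F G n) k :
  poincare_series rV k = nG^-1 * \sum_(g in G) \tr (rV g) ^+ k.
Proof.
rewrite /poincare_series dim_invariants; congr (_ * _).
by apply: eq_bigr => g Gg; rewrite mxtrace_tensor_power.
Qed.

End CharactersOverClosedField.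

(** * Partial fractions, and minors of a diagonalised matrix *)

Section SeriesOfGeometricSums.
Variable F : fieldType.

Lemma geometric_fps (d : F) (S : {poly F}) n :
  \sum_(i < n.+1) d ^+ i * ((1 - d *: 'X) * S)`_(n - i) = S`_n.
Proof.
elim: n => [|n IHn].
  by rewrite big_ord1 mul1r mulrBl mul1r -scalerAl coefB coefZ coefXM mulr0
    subr0.
rewrite big_ord_recl /= expr0 mul1r subn0.
under eq_bigr => i _ do rewrite /bump add1n subSS exprS -mulrA.
rewrite -mulr_sumr IHn mulrBl mul1r -scalerAl coefB coefZ coefXM /=.
by rewrite subrK.
Qed.

(** Partial fractions: P / Q is the sum of the c_i / (1 - d_i t), where [S i] is Q without its
    factor 1 - d_i t. *)
Lemma fps_div_geometric (I : finType) (A : pred I) (c d : I -> F)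
    (S : I -> {poly F}) (P Q : {poly F}) (f : nat -> F) :
  Q`_0 != 0 -> (forall i, A i -> Q = (1 - d i *: 'X) * S i) ->
  P = \sum_(i | A i) c i *: S i ->
  (forall k, f k = \sum_(i | A i) c i * d i ^+ k) ->
  f =1 fps_div P Q.
Proof.
move=> nzQ defQ -> def_f; apply/fps_divP => // n.
under eq_bigr => i _ do rewrite def_f mulr_suml.
rewrite exchange_big coef_sum /=; apply: eq_bigr => i Ai.
under eq_bigr => j _ do rewrite -mulrA.
rewrite coefZ -mulr_sumr; congr (_ * _); rewrite (defQ i Ai).
exact: geometric_fps.
Qed.

End SeriesOfGeometricSums.

Section DiagonalisedMatrix.
Variables (F : fieldType) (n : nat) (A X : 'M[F]_n) (d : 'I_n -> F).
Hypotheses (uX : X \in unitmx) (AX : A *m X = X *m diag_mx (\row_j d j)).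
Local Notation pM B := (map_mx (@polyC F) B).
Local Notation f j := (1 - d j *: 'X : {poly F}).

Let AXp : (1%:M - 'X *: pM A) *m pM X = pM X *m diag_mx (\row_j f j).
Proof.
rewrite mulmxBl mul1mx -scalemxAl -map_mxM AX map_mxM scalemxAr.
rewrite -{1}[pM X]mulmx1 -mulmxBr; congr (_ *m _); apply/matrixP => i j.
rewrite !mxE; case: eqP => _; rewrite ?mulr0n ?mulr1n ?polyC0 ?mulr0 ?subr0 //.
by rewrite -mul_polyC mulrC.
Qed.

Let uXp : \det (pM X) != 0.
Proof. by rewrite det_map_mx polyC_eq0 -unitfE -unitmxE. Qed.

Lemma det1X_diagonalised : det1X A = \prod_j f j.
Proof.
apply: (mulIf uXp); rewrite /det1X -det_mulmx AXp det_mulmx det_diag mulrC.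
by congr (_ * _); apply: eq_bigr => j _; rewrite mxE.
Qed.

Lemma det1X_coef0_neq0 (B : 'M[F]_n) : (det1X B)`_0 != 0.
Proof.
rewrite -horner_coef0 -[_.[0]]/(horner_eval 0 _) -det_map_mx.
suff ->: map_mx (horner_eval 0) (1%:M - 'X *: pM B) = 1%:M.
  by rewrite det1 oner_eq0.
apply/matrixP => i j; rewrite !mxE horner_evalE hornerD hornerN hornerM hornerX
  mul0r subr0.
by case: (i == j); rewrite ?mulr1n ?mulr0n !hornerE.
Qed.

(** The left side is the (i, i) entry of the adjugate of I - tA. Diagonalisation writes this
    adjugate as X D' X^-1, where entry j of the diagonal D' is the product of all factors but the
    j-th, and [c] is column [i] of X^-1. *)
Lemma det1X_row'_col' (i : 'I_n) (c : 'I_n -> F) :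
  (forall k, \sum_j X k j * c j = (k == i)%:R) ->
  det1X (row' i (col' i A)) = \sum_j (X i j * c j) *: \prod_(k | k != j) f k.
Proof.
move=> Xc; set M := 1%:M - 'X *: pM A.
pose Y := pM X *m diag_mx (\row_j \prod_(k | k != j) f k) *m pM (invmx X).
have MY : M *m Y = (det1X A)%:M.
  rewrite /Y !mulmxA AXp -(mulmxA (pM X)) mulmx_diag.
  have -> : diag_mx (\row_j ((\row_k f k) 0 j * (\row_j \prod_(k | k != j) f k)
    0 j))
             = (det1X A)%:M.
    rewrite det1X_diagonalised; apply/matrixP => a b; rewrite !mxE.
    case: (a =P b) => [-> | _]; last by rewrite !mulr0n.
    by rewrite !mulr1n [RHS](bigD1 b).
  by rewrite scalar_mxC -mulmxA -map_mxM mulmxV // map_mx1 mulmx1.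
have detM0 : det1X A != 0.
  by apply: contraNneq (det1X_coef0_neq0 A) => ->; rewrite coef0.
(* M Y = det M identifies Y with the adjugate because det M is a nonzero polynomial and can be
   cancelled. *)
have defY : Y = \adj M.
  have: \adj M *m M *m Y = (\det M) *: \adj M.
    by rewrite -mulmxA MY mul_mx_scalar.
  rewrite mul_adj_mx mul_scalar_mx => eqY; apply/matrixP => a b.
  by move/matrixP/(_ a b): eqY; rewrite !mxE => /(mulfI detM0).
have XVi j : invmx X j i = c j.
  have: X *m \col_k c k = delta_mx i 0.
    apply/matrixP => k l; rewrite !mxE ord1 eqxx andbT -Xc.
    by apply: eq_bigr => a _; rewrite mxE.
  move/(congr1 (mulmx (invmx X))); rewrite mulKmx // -colE.
  by move/matrixP/(_ j 0); rewrite !mxE.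
transitivity (Y i i); last first.
  rewrite mxE; apply: eq_bigr => j _; rewrite mul_mx_diag !mxE XVi.
  by rewrite -mul_polyC polyCM mulrAC.
rewrite defY mxE /cofactor addnn -signr_odd odd_double mul1r; congr (\det _).
by apply/matrixP => a b; rewrite !mxE (inj_eq lift_inj).
Qed.

End DiagonalisedMatrix.

Section RepresentationGraph.
Variables (F : closedFieldType) (gT : finGroupType) (G : {group gT}).
Hypothesis F0 : [pchar F] =i pred0.
Variables (n : nat) (V : mx_representation F G n) (Gamma : {set gT}).
Hypothesis trG : is_transversal Gamma (classes G) G.
Local Notation sG := (irr_index F G).
Local Notation nG := (#|G|%:R : F).

Lemma sum_transversal (phi : gT -> F) :
  {in G &, forall g h, phi (g ^ h)%g = phi g} ->
  \sum_(g in G) phi g = \sum_(g in Gamma) #|g ^: G|%:R * phi g.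
Proof.
move=> phiJ; have [parG _] := andP trG; have tiG := partition_trivIset parG.
have sGamma := subsetP (transversal_sub trG).
have pb g : g \in G -> pblock (classes G) g = g ^: G.
  by move=> Gg; apply: def_pblock tiG _ (class_refl _ _); apply: mem_classes.
rewrite -{1}(cover_partition parG) big_trivIset // -{1}(pblock_transversal trG).
rewrite big_imset /=; last exact: pblock_inj trG.
apply: eq_bigr => g /sGamma Gg; rewrite pb // (eq_bigr (fun=> phi g)).
  by rewrite sumr_const mulr_natl.
by move=> _ /imsetP[h Gh ->]; apply: phiJ.
Qed.

Local Notation c g := (#|g ^: G|%:R / nG).
Local Notation f g := (1 - \tr (V g) *: 'X : {poly F}).

Let nG_neq0 : nG != 0.
Proof. by have /pcharf0P -> := F0; rewrite -lt0n cardG_gt0. Qed.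

Lemma poincare_series_classes k :
  poincare_series V k = \sum_(g in Gamma) c g * \tr (V g) ^+ k.
Proof.
rewrite poincare_seriesE // sum_transversal => [|g h Gg Gh]; last first.
  by rewrite mxtrace_conj.
by rewrite mulr_sumr; apply: eq_bigr => g _; rewrite mulrA [nG^-1 * _]mulrC.
Qed.

Lemma card_Gamma : #|Gamma| = #|sG|.
Proof. by rewrite (card_transversal trG) card_irr_index. Qed.

Let rep (j : 'I_#|sG|) : gT := enum_val (cast_ord (esym card_Gamma) j).

Let Gamma_rep j : rep j \in Gamma. Proof. exact: enum_valP. Qed.

Let G_rep j : rep j \in G.
Proof. exact: subsetP (transversal_sub trG) _ (Gamma_rep j). Qed.

Let rep_inj : injective rep.
Proof. by move=> i j /enum_val_inj/cast_ord_inj. Qed.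

Let big_rep (T : Type) (idx : T) (op : Monoid.com_law idx) (phi : gT -> T) :
  \big[op/idx]_(g in Gamma) phi g = \big[op/idx]_j phi (rep j).
Proof.
rewrite big_enum_val (reindex (cast_ord (esym card_Gamma))) //.
by exists (cast_ord card_Gamma) => i _; rewrite ?cast_ordK ?cast_ordKV.
Qed.

Let sum_enum (phi : sG -> F) : \sum_l phi l = \sum_(j < #|sG|) phi (enum_val j).
Proof. by rewrite (reindex _ (onW_bij _ (enum_val_bij sG))). Qed.

Let X := \matrix_(i < #|sG|, j < #|sG|) \tr (irr_repr (enum_val i) (rep j)).

(** A row of the left kernel of the character table is a relation between irreducible characters on
    [Gamma], hence on all of G, where they are free. *)
Let uX : X \in unitmx.
Proof.
rewrite -row_free_unit -kermx_eq0; apply/eqP/matrixP => a b; rewrite [RHS]mxE.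
pose u l := kermx X a (enum_rank l).
suff: u (enum_val b) = 0 by rewrite /u enum_valK.
apply: irr_characters_free => // g Gg.
have [parG _] := andP trG.
have: g ^: G \in classes G by apply: mem_classes.
rewrite -(pblock_transversal trG) => /imsetP[h Gh def_g].
have [j def_h]: exists j, h = rep j.
  exists (cast_ord card_Gamma (enum_rank_in Gh h)).
  by rewrite /rep cast_ordK enum_rankK_in.
have /imsetP[y Gy ->] : g \in rep j ^: G.
  rewrite -def_h -(def_pblock (partition_trivIset parG) _ (class_refl G h)).
    by rewrite -def_g class_refl.
  by apply: mem_classes; rewrite def_h.
under eq_bigr => l _ do rewrite mxtrace_conj //.
transitivity ((kermx X *m X) a j); last by rewrite mulmx_ker mxE.
rewrite [RHS]mxE sum_enum; apply: eq_bigr => i _.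
by rewrite /u enum_valK [X in _ = _ * X]mxE.
Qed.

(** Both entries are the character of the tensor product of the i-th irreducible with V at the j-th
    class, once decomposed into irreducibles and once as a product of traces. *)
Let AX : repr_graph V *m X = X *m diag_mx (\row_j \tr (V (rep j))).
Proof.
apply/matrixP => i j; rewrite mul_mx_diag !mxE -mxtrace_prod.
rewrite -[tprod _ _]/(prod_repr (irr_repr (enum_val i)) V (rep j)).
rewrite mxtrace_irr_mult // sum_enum; apply: eq_bigr => k _.
by rewrite !mxE.
Qed.

(** Orthogonality to the trivial character: the weights of the classes form the column of the
    inverse character table at the affine node. *)
Let Xc k : \sum_j X k j * c (rep j) = (k == affine_node F G)%:R.
Proof.
transitivity (nG^-1 * \sum_(g in G) \tr (irr_repr (enum_val k) g)).
  rewrite sum_transversal => [|g h Gg Gh]; last by rewrite mxtrace_conj.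
  rewrite big_rep mulr_sumr; apply: eq_bigr => j _; rewrite mxE.
  by rewrite [RHS]mulrC mulrA [in RHS](mulrC _%:R).
rewrite sum_irr_character // -(inj_eq enum_val_inj) enum_rankK.
by case: eqP; rewrite ?mulr1n ?mulr0n ?mulr0 ?mulVf.
Qed.

Lemma det1X_repr_graph : det1X (repr_graph V) = \prod_(g in Gamma) f g.
Proof. by rewrite (det1X_diagonalised uX AX) big_rep. Qed.

Lemma det1X_finite_graph :
  det1X (finite_graph V) =
    \sum_(g in Gamma) c g *: \prod_(h in Gamma | h != g) f h.
Proof.
rewrite (det1X_row'_col' uX AX Xc) big_rep; apply: eq_bigr => j _.
rewrite mxE enum_rankK irr1_repr // mxtrace1 degree_irr1 mul1r; congr (_ *: _).
rewrite [RHS]big_mkcondr big_rep -big_mkcond /=.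
by apply: eq_bigl => k; rewrite (inj_eq rep_inj).
Qed.

Lemma poincare_series_det :
  poincare_series V =1 fps_div (det1X (finite_graph V)) (det1X (repr_graph V)).
Proof.
apply: (@fps_div_geometric _ _ (mem Gamma) (fun g => c g) (fun g => \tr (V g))
         (fun g => \prod_(h in Gamma | h != g) f h)).
- exact: det1X_coef0_neq0.
- by move=> g Gg; rewrite det1X_repr_graph (bigD1 g).
- exact: det1X_finite_graph.
- exact: poincare_series_classes.
Qed.

End RepresentationGraph.

(** * Roots of unity and exponents *)

Section Joukowski.
Variable F : fieldType.
Implicit Types z w : F.

Definition joukowski z : F := z + z^-1.
Local Notation J := joukowski.

(** This keeps J z - J e invertible for every root of unity e. *)
Definition non_unity_root z := (z != 0) /\ forall k, z ^+ k.+1 != 1.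

Lemma joukowskiB z w : z != 0 -> w != 0 -> J z - J w = (z - w) * (z - w^-1) / z.
Proof. by move=> z0 w0; rewrite /J; field; rewrite z0 w0. Qed.

Lemma non_unity_rootP z k : non_unity_root z -> (0 < k)%N -> z ^+ k - 1 != 0.
Proof. by case=> _ zk; case: k => // k _; rewrite subr_eq0. Qed.

Lemma horner_deriv_prod_XsubC (rs : seq F) z : z \notin rs ->
  (\prod_(x <- rs) ('X - x%:P))^`().[z] =
    \prod_(x <- rs) (z - x) * \sum_(x <- rs) (z - x)^-1.
Proof.
elim: rs => [|x rs IHrs]; first by rewrite !big_nil derivC horner0 mulr0.
rewrite inE negb_or -subr_eq0 => /andP[zx /IHrs E].
have hp: (\prod_(y <- rs) ('X - y%:P)).[z] = \prod_(y <- rs) (z - y).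
  by rewrite horner_prod; apply: eq_bigr => y _; rewrite !hornerE.
rewrite !big_cons derivM derivXsubC mul1r hornerD hornerM E hornerXsubC hp.
by move: (\prod_(y <- rs) _) (\sum_(y <- rs) _) => P S; field.
Qed.

Lemma prod_unity_roots (rs : seq F) m : uniq rs -> size rs = m -> (0 < m)%N ->
  {in rs, forall x, x ^+ m = 1} -> \prod_(x <- rs) ('X - x%:P) = 'X^m - 1.
Proof.
move=> Urs szrs m0 rs1; have sz: size ('X^m - 1 : {poly F}) = (size rs).+1.
  by rewrite size_XnsubC ?szrs.
rewrite [RHS](all_roots_prod_XsubC sz) ?uniq_rootsE //.
  by rewrite (monicP (monicXnsubC 1 m0)) scale1r.
by apply/allP => x /rs1 x1; rewrite rootE !hornerE x1 subrr.
Qed.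

(** The identity (z - 1/z) / (J z - J x) = z (1/(z - x) + 1/(z - 1/x) - 1/z) reduces the sum to that
    of the 1/(z - x), which is the logarithmic derivative of z^m - 1; inversion permutes the roots,
    so the second term has the same sum. *)
Lemma sum_joukowski_unity_roots (rs : seq F) m z :
    uniq rs -> size rs = m -> (0 < m)%N ->
    {in rs, forall x, x ^+ m = 1} -> non_unity_root z ->
  \sum_(x <- rs) (J z - J x)^-1 =
    m%:R * (z ^+ m + 1) / ((z ^+ m - 1) * (z - z^-1)).
Proof.
move=> Urs szrs m0 rs1 Uz; have [z0 _] := Uz.
have zm: z ^+ m - 1 != 0 by apply: non_unity_rootP.
have z2: z ^+ 2 - 1 != 0 by apply: non_unity_rootP.
have zrs: z \notin rs by apply: contraNN zm => /rs1->; rewrite subrr.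
have x0 x : x \in rs -> x != 0.
  move/rs1; apply: contra_eq_neq => ->.
  by rewrite expr0n (gtn_eqF m0) eq_sym oner_neq0.
have zx x : x \in rs -> z - x != 0.
  by move=> rs_x; rewrite subr_eq0; apply: contraNneq zrs => ->.
have sumV : \sum_(x <- rs) (z - x)^-1 = m%:R * z ^+ m.-1 / (z ^+ m - 1).
  apply: (mulfI zm); rewrite [RHS]mulrC divfK //.
  have := horner_deriv_prod_XsubC zrs.
  rewrite (prod_unity_roots Urs szrs m0 rs1) derivB derivXn derivC subr0
    hornerMn hornerXn.
  rewrite -mulr_natl => ->; congr (_ * _).
  have := congr1 (horner^~ z) (prod_unity_roots Urs szrs m0 rs1).
  rewrite horner_prod !hornerE => <-.
  by apply: eq_bigr => y _; rewrite !hornerE.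
have sumV' : \sum_(x <- rs) (z - x^-1)^-1 = m%:R * z ^+ m.-1 / (z ^+ m - 1).
  rewrite -sumV -[LHS](big_map (@GRing.inv F) xpredT (fun x => (z - x)^-1)).
  apply: perm_big; apply: uniq_perm => //.
    by rewrite map_inj_uniq //; apply: invr_inj.
  have sub : {subset map (@GRing.inv F) rs <= rs}.
    move=> _ /mapP[x rs_x ->].
    have := congr1 (root^~ x^-1) (prod_unity_roots Urs szrs m0 rs1).
    rewrite root_prod_XsubC => ->.
    by rewrite rootE !hornerE exprVn rs1 // invr1 subrr.
  have Uinv : uniq (map (@GRing.inv F) rs) by rewrite map_inj_uniq //;
    apply: invr_inj.
  by case: (uniq_min_size Uinv sub); rewrite ?size_map.
have zzV : z - z^-1 != 0.
  apply: contraNneq z2 => zV; rewrite expr2 -[X in _ - X](mulfV z0) -mulrBr zV.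
  by rewrite mulr0.
apply: (mulIf zzV); rewrite mulr_suml.
transitivity (\sum_(x <- rs) ((z - x)^-1 + (z - x^-1)^-1 - z^-1) * z).
  rewrite !big_seq; apply: eq_bigr => x rs_x.
  have xV_rs : z - x^-1 != 0.
    apply: contraNneq zm => /eqP; rewrite subr_eq0 => /eqP ->.
    by rewrite exprVn rs1 // invr1 subrr.
  rewrite (joukowskiB z0 (x0 x rs_x)).
  move: (x0 x rs_x) (zx x rs_x) xV_rs => nx0 nzx nxV.
  have nxz : z * x - 1 != 0.
    by apply: contraNneq nxV => E; rewrite -[z](mulfK nx0) -{2}[x^-1]mul1r
      -mulrBl E mul0r.
  by field; rewrite z0 nx0 nxz nzx.
rewrite -big_distrl /= !big_split /= sumV sumV' sumrN big_const_seq count_predT.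
rewrite iter_addr_0 szrs -[z^-1 *+ m]mulr_natl.
case: m m0 zm {szrs rs1 sumV sumV'} => // m _ zm; rewrite /= exprS in zm *.
have nz1 : z * z - 1 != 0 by rewrite -expr2.
by field; rewrite z0 zm nz1.
Qed.

Lemma prim_root_neq0 n w : n.-primitive_root w -> w != 0.
Proof.
move=> prim_w; apply: contra_eq_neq (prim_expr_order prim_w) => ->.
by rewrite expr0n (gtn_eqF (prim_order_gt0 prim_w)) eq_sym oner_neq0.
Qed.

Lemma prim_expr_half n w : (2 * n).-primitive_root w -> w ^+ n = -1.
Proof.
move=> prim_w; have := prim_order_gt0 prim_w; rewrite muln_gt0 => /andP[_ n0].
have /eqP : (w ^+ n) ^+ 2 = 1 by rewrite -exprM mulnC prim_expr_order.
rewrite sqrf_eq1 => /predU1P[wn1 | /eqP //].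
have /(dvdn_leq n0) : (2 * n %| n)%N by rewrite (prim_order_dvd prim_w) wn1.
by rewrite leqNgt ltn_Pmull.
Qed.

Lemma prod_sub_unity_roots n w z : n.-primitive_root w ->
  \prod_(0 <= i < n) (z - w ^+ i) = z ^+ n - 1.
Proof.
move=> /factor_Xn_sub_1/(congr1 (horner^~ z));
  rewrite horner_prod !hornerE => <-.
by apply: eq_bigr => i _; rewrite !hornerE.
Qed.

(** The 2n-th roots of unity are 1, -1 and the pairs w^m, w^-m with 0 < m < n; a pair contributes z
    (J z - J (w^m)) to z^(2n) - 1. *)
Lemma prod_joukowski_even n w z : (2 * n).-primitive_root w ->
    z != 0 -> z ^+ 2 - 1 != 0 ->
  \prod_(m <- iota 1 n.-1) (J z - J (w ^+ m)) =
     (z ^+ n - z ^- n) / (z - z^-1).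
Proof.
move=> prim_w z0 z2; have := prim_order_gt0 prim_w.
rewrite muln_gt0 => /andP[_ n0]; have w0 := prim_root_neq0 prim_w.
rewrite -subn1 -/(index_iota 1 n).
pose P := \prod_(1 <= m < n) (z - w ^+ m).
pose P' := \prod_(1 <= m < n) (z - w ^- m).
have -> : \prod_(1 <= m < n) (J z - J (w ^+ m)) = P * P' * z ^- n.-1.
  rewrite -subn1 -exprVn -prodr_const_nat -!big_split /=; apply: eq_bigr => m _.
  by rewrite joukowskiB ?expf_neq0.
have tail : \prod_(1 + n <= i < n + n) (z - w ^+ i) = P'.
  rewrite big_nat_rev big_addn addnK; apply: eq_big_nat => i /andP[_ lt_in].
  congr (_ - _); apply: (mulIf (expf_neq0 i w0)); rewrite mulVf ?expf_neq0 //.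
  rewrite -exprD [X in _ ^+ X](_ : _ = 2 * n)%N ?(prim_expr_order prim_w) //.
  lia.
have : (z ^+ 2 - 1) * (P * P') = z ^+ (2 * n) - 1.
  rewrite -(prod_sub_unity_roots z prim_w) mul2n -addnn big_ltn ?addn_gt0 ?n0
    //.
  rewrite expr0 (@big_cat_nat _ _ _ n) ?leq_addr //=.
  rewrite (@big_ltn _ _ _ n) //; last by lia.
  by rewrite (prim_expr_half prim_w) opprK tail -/P expr2; ring.
move: (P * P') => Q {P P' tail prim_w}; case: n n0 => // k _ E.
have -> : Q = (z ^+ (2 * k.+1) - 1) / (z ^+ 2 - 1) by rewrite -E mulrAC mulfV
  ?mul1r.
rewrite mulnC exprM !exprS in z2 *; set y := z ^+ k.
have y0 : y != 0 by apply: expf_neq0.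
by move: z2; rewrite expr0 mulr1 => z2; field; rewrite z0 y0 z2.
Qed.

(** The odd powers of w are the roots of z^(2n) + 1 and again form n pairs of inverses. Their
    product is that of the 2n-th roots of unity taken at z / w and rescaled. *)
Lemma prod_joukowski_odd n w z : (4 * n).-primitive_root w -> z != 0 ->
  \prod_(m <- [seq (2 * i).+1 | i <- iota 0 n]) (J z - J (w ^+ m)) =
     z ^+ n + z ^- n.
Proof.
move=> prim_w z0; have := prim_order_gt0 prim_w.
rewrite muln_gt0 => /andP[_ n0]; have w0 := prim_root_neq0 prim_w.
have prim_w2 : (2 * n).-primitive_root (w ^+ 2).
  have := dvdn_prim_root prim_w (_ : 2 * n %| 4 * n)%N.
  by rewrite -[4%N]/(2 * 2)%N -mulnA dvdn_mull // mulnK ?muln_gt0 // => ->.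
have wN1 : w ^+ (2 * n) = -1 by rewrite exprM (prim_expr_half prim_w2).
rewrite big_map -{1}[n]subn0 -/(index_iota 0 n).
pose P := \prod_(0 <= i < n) (z - w ^+ (2 * i).+1).
pose P' := \prod_(0 <= i < n) (z - w ^- (2 * i).+1).
have -> : \prod_(0 <= i < n) (J z - J (w ^+ (2 * i).+1)) = P * P' * z ^- n.
  have -> : z ^- n = \prod_(0 <= i < n) z^-1 by rewrite prodr_const_nat subn0
    exprVn.
  rewrite -!big_split /=; apply: eq_bigr => m _.
  by rewrite joukowskiB ?expf_neq0.
have -> : P * P' = z ^+ (2 * n) + 1.
  have := prod_sub_unity_roots (z / w) prim_w2.
  move/(congr1 ( *%R (w ^+ (2 * n)))); rewrite mulrBr mulr1 expr_div_n mulrCA.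
  rewrite mulfV ?expf_neq0 // mulr1 wN1 opprK => <-.
  have -> : -1 = \prod_(0 <= i < 2 * n) w by rewrite prodr_const_nat subn0.
  rewrite -[RHS]big_split /=.
  rewrite mul2n -addnn [RHS](@big_cat_nat _ _ _ n) ?leq_addr //=; congr (_ * _).
    by apply: eq_bigr => i _; rewrite mulrBr mulrCA mulfV // mulr1 exprS exprM.
  rewrite -{1}[n]add0n big_addn addnK [RHS]big_nat_rev.
  apply: eq_big_nat => i /andP[_ lt_in].
  rewrite mulrBr mulrCA mulfV // mulr1; congr (_ - _).
  apply: (mulIf (expf_neq0 (2 * i).+1 w0)); rewrite mulVf ?expf_neq0 //.
  rewrite -exprM -exprS -exprD.
  rewrite [X in _ ^+ X](_ : _ = 4 * n)%N ?(prim_expr_order prim_w) //.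
  lia.
rewrite mulnC exprM; set y := z ^+ n; have y0 : y != 0 by apply: expf_neq0.
by field.
Qed.
End Joukowski.

(** The integers n + 2 are not roots of unity, and J is injective on them, since J a = J b forces a
    = b or a b = 1. Hence p - q has more roots than its size allows unless it is 0. *)
Lemma poly_eq_joukowski (F : numFieldType) (p q : {poly F}) :
  (forall z, non_unity_root z -> p.[(joukowski z)^-1] = q.[(joukowski z)^-1]) ->
  p = q.
Proof.
move=> eq_pq; apply/eqP; rewrite -subr_eq0; apply/negPn/negP => nz_pq.
pose t n : F := (joukowski n.+2%:R)^-1.
have t_inj : injective t.
  move=> m n /invr_inj/eqP; rewrite -subr_eq0 joukowskiB ?pnatr_eq0 //.
  rewrite !mulf_eq0 invr_eq0 pnatr_eq0 orbF subr_eq0 eqr_nat => /orP[/eqP[]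
    //|].
  rewrite subr_eq0 => /eqP /(congr1 ( *%R^~ n.+2%:R));
    rewrite mulVf ?pnatr_eq0 //.
  by rewrite -natrM => /eqP; rewrite (eqr_nat _ _ 1).
have := max_poly_roots nz_pq; move/(_ (map t (iota 0 (size (p - q))))).
rewrite map_inj_uniq // iota_uniq size_map size_iota ltnn => /(_ _ isT).
move=> not_roots; suff /not_roots : all (root (p - q)) (map t (iota 0 (size (p
  - q)))) by [].
apply/allP => _ /mapP[n _ ->].
rewrite rootE hornerD hornerN eq_pq ?subrr //; split=> [|k].
  by rewrite pnatr_eq0.
by rewrite -natrX (eqr_nat _ _ 1) -(exp1n k.+1) eqn_exp2r.
Qed.

(** To compare coefficients up to N, the series P / Q is truncated to a polynomial f. Then (f Q' -
    P') Q = (f Q - P) Q' has no term of degree at most N, and neither has f Q' - P', as Q has an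
    invertible constant coefficient. *)
Lemma fps_div_cross (F : fieldType) (P Q P' Q' : {poly F}) :
  Q`_0 != 0 -> Q'`_0 != 0 -> P * Q' = P' * Q -> fps_div P Q =1 fps_div P' Q'.
Proof.
move=> nzQ nzQ' eqPQ; apply/(fps_divP _ _ nzQ') => N.
pose f := \poly_(i < N.+1) fps_div P Q i.
have coef_mul (S : {poly F}) n : (n <= N)%N ->
    (f * S)`_n = \sum_(i < n.+1) fps_div P Q i * S`_(n - i).
  move=> le_nN; rewrite coefM; apply: eq_bigr => i _; rewrite coef_poly.
  by rewrite ltnS (leq_trans _ le_nN) // -ltnS.
rewrite -coef_mul //; apply/eqP; rewrite -subr_eq0 -coefB; apply/eqP.
have fQ n : (n <= N)%N -> (f * Q - P)`_n = 0.
  move=> le_nN; rewrite coefB coef_mul //.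
  by have /(fps_divP _ _ nzQ)-> : fps_div P Q =1 fps_div P Q; rewrite ?subrr.
have HQ n : (n <= N)%N -> ((f * Q' - P') * Q)`_n = 0.
  have -> : (f * Q' - P') * Q = (f * Q - P) * Q' by rewrite !mulrBl eqPQ mulrAC.
  move=> le_nN; rewrite coefM big1 // => i _; rewrite fQ ?mul0r //.
  by apply: leq_trans le_nN; rewrite -ltnS.
suff: forall n, (n <= N)%N -> (f * Q' - P')`_n = 0 by apply.
elim/ltn_ind => n IHn le_nN; apply: (mulIf nzQ); rewrite mul0r.
transitivity ((f * Q' - P') * Q)`_n; last exact: HQ.
rewrite coefM big_ord_recr /= subnn big1 ?add0r // => i _.
by rewrite IHn ?mul0r // (leq_trans (ltnW (ltn_ord i))).
Qed.

Section Exponents.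
Variable R : realType.
Local Notation J := (@joukowski _).
Local Open Scope complex_scope.

Definition cis (x : R) : R[i] := cos x +i* sin x.
(** The order is 2h, not h, so that J takes the value 2 cos (pi m / h) at the m-th power. *)
Definition unity_exp (h : nat) : R[i] := cis (pi / h%:R).
Local Notation w := unity_exp.

Lemma cis_neq0 x : cis x != 0.
Proof.
apply/eqP => [[c0 s0]]; have := cos2Dsin2 x; rewrite c0 s0 !expr0n addr0.
by apply/eqP; rewrite eq_sym oner_neq0.
Qed.

Lemma cisX x n : cis x ^+ n = cis (x *+ n).
Proof.
elim: n => [|n IHn]; first by rewrite expr0 mulr0n /cis cos0 sin0.
rewrite exprS IHn mulrS /cis cosD sinD; apply/eqP;
  rewrite eq_complex /= eqxx /=.
by rewrite addrC.
Qed.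

Lemma joukowski_cis x : J (cis x) = (2 * cos x)%:C.
Proof.
have -> : J (cis x) = cis x + cis (- x).
  congr (_ + _); apply: (mulfI (cis_neq0 x)); rewrite mulfV ?cis_neq0 //.
  rewrite /cis cosN sinN; apply/eqP; rewrite eq_complex /= -!expr2 mulrN opprK.
  by rewrite -expr2 cos2Dsin2 eqxx mulrN mulrC addNr eqxx.
rewrite /cis cosN sinN; apply/eqP; rewrite eq_complex /= subrr eqxx andbT.
by rewrite -mulr2n mulr_natl.
Qed.

Lemma joukowski_unity_exp h m : J (w h ^+ m) = (2 * cos (pi * m%:R / h%:R))%:C.
Proof. by rewrite cisX joukowski_cis -[_ *+ m]mulr_natr mulrAC. Qed.

Lemma unity_expM k h : (0 < k)%N -> (0 < h)%N -> w (k * h) ^+ k = w h.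
Proof.
move=> k0 h0; rewrite cisX; congr cis; rewrite -mulr_natr natrM.
by field; rewrite !pnatr_eq0 -!lt0n k0 h0.
Qed.

Lemma cis_eq1 x : 0 <= x <= pi -> cis x = 1 -> x = 0.
Proof.
move=> x_pi [cx _]; apply: cos_inj; rewrite ?cos0 // in_itv //=.
by rewrite lexx pi_ge0.
Qed.

(** Injectivity of cos on [0, pi] excludes only the exponents from 1 to h. For an order k above h,
    the exponent 2h - k is again in the range covered, so it is 0. *)
Lemma unity_exp_prim h : (0 < h)%N -> (2 * h).-primitive_root (w h).
Proof.
move=> h0; have hR : (h%:R : R) != 0 by rewrite pnatr_eq0 -lt0n.
have wh : w h ^+ h = -1.
  rewrite cisX -[_ *+ h]mulr_natr divfK // /cis cospi sinpi.
  by apply/eqP; rewrite eq_complex /= oppr0 !eqxx.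
have w2h : w h ^+ (2 * h) = 1 by rewrite mulnC exprM wh sqrrN expr1n.
have small k : (k <= h)%N -> w h ^+ k = 1 -> k = 0%N.
  move=> le_kh; rewrite cisX -[_ *+ k]mulr_natr mulrAC => /cis_eq1 E.
  have /eqP : pi * k%:R / h%:R = 0 :> R.
    apply: E; rewrite divr_ge0 ?mulr_ge0 ?ler0n ?pi_ge0 //=.
    by rewrite ler_pdivrMr ?ltr0n // ler_pM2l ?pi_gt0 // ler_nat.
  by rewrite !mulf_eq0 invr_eq0 (negPf hR) orbF gt_eqF ?pi_gt0 //= pnatr_eq0 =>
    /eqP.
have h20 : (0 < 2 * h)%N by rewrite muln_gt0.
have [k prim_k dvd_k] := prim_order_exists h20 w2h.
suff <- : k = (2 * h)%N by [].
have k0 := prim_order_gt0 prim_k; have wk := prim_expr_order prim_k.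
have lt_hk : (h < k)%N.
  by rewrite ltnNge; apply/negP => /small/(_ wk) E; rewrite E in k0.
have le_k : (k <= 2 * h)%N := dvdn_leq h20 dvd_k.
have : (2 * h - k <= h)%N by lia.
move=> /small E; have : w h ^+ (2 * h - k) = 1.
  by apply: (mulIf (oner_neq0 _)); rewrite -{1}wk -exprD subnK // mul1r.
by move/E; lia.
Qed.

Definition exponent_prod (ms : seq nat) h (z : R[i]) : R[i] :=
  \prod_(m <- ms) (J z - J (w h ^+ m)).
Local Notation EP := exponent_prod.

Lemma horner_exponent_poly ms h z : J z != 0 ->
  (exponent_poly R ms h).[(J z)^-1] = (J z) ^- size ms * EP ms h z.
Proof.
move=> z0; rewrite /exponent_poly horner_prod -exprVn.
have -> : (J z)^-1 ^+ size ms = \prod_(m <- ms) (J z)^-1.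
  by rewrite big_const_seq count_predT -Monoid.iteropE.
rewrite -big_split; apply: eq_bigr => m _ /=.
rewrite hornerD hornerN hornerZ hornerX hornerC -joukowski_unity_exp.
by rewrite mulrBr mulVf // mulrC.
Qed.

Lemma exponent_poly_coef0 ms h : (exponent_poly R ms h)`_0 = 1.
Proof.
rewrite -horner_coef0 horner_prod big1 // => m _.
by rewrite hornerD hornerN hornerZ hornerX hornerC mulr0 subr0.
Qed.

Lemma exponent_prod_cat ms ms' h z : EP (ms ++ ms') h z = EP ms h z * EP ms' h
  z.
Proof. exact: big_cat. Qed.

Lemma exponent_prod_cons m ms h z :
  EP (m :: ms) h z = (J z - J (w h ^+ m)) * EP ms h z.
Proof. exact: big_cons. Qed.

Lemma exponent_prod_nil h z : EP [::] h z = 1.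
Proof. exact: big_nil. Qed.

Lemma exponent_prod_perm ms ms' h z : perm_eq ms ms' -> EP ms h z = EP ms' h z.
Proof. exact: perm_big. Qed.

Lemma exponent_prod_scale k ms h z : (0 < k)%N -> (0 < h)%N ->
  EP [seq (k * m)%N | m <- ms] (k * h) z = EP ms h z.
Proof.
move=> k0 h0; rewrite /EP big_map; apply: eq_bigr => m _.
by rewrite exprM unity_expM.
Qed.

Lemma joukowski_exp0 h : J (w h ^+ 0) = 2.
Proof. by rewrite /J expr0 invr1. Qed.

Lemma joukowski_exp_half h : (0 < h)%N -> J (w (2 * h) ^+ h) = 0.
Proof.
move=> h0; rewrite joukowski_unity_exp natrM.
have -> : pi * h%:R / (2 * h%:R) = pi / 2 :> R.
  by field; rewrite !pnatr_eq0 -lt0n h0.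
by rewrite cos_pihalf mulr0.
Qed.

Lemma joukowski_exp_order h : (0 < h)%N -> J (w h ^+ h) = -2.
Proof.
move=> h0; rewrite (prim_expr_half (unity_exp_prim h0)) /J invrN invr1.
by rewrite -opprD.
Qed.

Lemma exponent_prod_iota n z : (0 < n)%N -> non_unity_root z ->
  EP (iota 1 n.-1) n z = (z ^+ n - z ^- n) / (z - z^-1).
Proof.
move=> n0 Uz; rewrite -(prod_joukowski_even (unity_exp_prim n0)) ?Uz.1 //.
exact: non_unity_rootP.
Qed.

Lemma exponent_prod_odd n z : (0 < n)%N -> non_unity_root z ->
  EP [seq (2 * i).+1 | i <- iota 0 n] (2 * n) z = z ^+ n + z ^- n.
Proof.
move=> n0 Uz; apply: prod_joukowski_odd; last exact: Uz.1.
by rewrite -[4%N]/(2 * 2)%N -mulnA; apply: unity_exp_prim; rewrite muln_gt0.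
Qed.
End Exponents.

(* 1 / 2n times the sum of the 1 / (z + 1/z - w - 1/w) over the 2n-th roots of
   unity w. *)
Definition cyclic_series (F : fieldType) n (z : F) :=
  (z ^+ (2 * n) + 1) / ((z ^+ (2 * n) - 1) * (z - z^-1)).

(** This will be m^0(1 / J z) / J z. The term in [cyclic_series 1] corrects for the central
    elements, which lie in every axis. *)
Definition pole_series (F : fieldType) (L : seq nat) (z : F) :=
  2^-1 * (\sum_(n <- L) cyclic_series n z - ((size L)%:R - 2) * cyclic_series 1
    z).

(** * The quotients of exponent products, type by type *)

Section McKayIdentities.
Variables (R : realType) (z : R[i]).
Hypothesis Uz : non_unity_root z.
Local Notation EP ms h := (exponent_prod ms h z).
Local Notation X := (joukowski z).
Local Notation C n := (z ^+ n + z ^- n).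
Local Notation E n := (cyclic_series n z).

Let z0 : z != 0. Proof. exact: Uz.1. Qed.

Let zB n : (0 < n)%N -> z ^+ n - 1 != 0. Proof. exact: non_unity_rootP. Qed.

Let zD n : (0 < n)%N -> z ^+ n + 1 != 0.
Proof.
move=> n0; have := @zB (n * 2) _; rewrite muln_gt0 n0 exprM => /(_ isT).
by rewrite -[1 in X in X -> _](expr1n _ 2) subr_sqr mulf_eq0 negb_or => /andP[].
Qed.

Let zBV n : (0 < n)%N -> z ^+ n - z ^- n != 0.
Proof.
move=> n0; apply: contraNneq (@zB (n * 2) _); last by rewrite muln_gt0 n0.
move=> E0; have := congr1 ( *%R (z ^+ n)) E0.
by rewrite mulrBr mulr0 mulfV ?expf_neq0 // exprM expr2 => ->.
Qed.

Let C_neq0 n : (0 < n)%N -> C n != 0.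
Proof.
move=> n0; apply: contraNneq (@zD (n * 2) _); last by rewrite muln_gt0 n0.
move=> E0; have := congr1 ( *%R (z ^+ n)) E0.
by rewrite mulrDr mulr0 mulfV ?expf_neq0 // exprM expr2 => ->.
Qed.

Let X_neq0 : X != 0. Proof. by have := @C_neq0 1 isT; rewrite expr1. Qed.

Lemma pole_series_cyclic n : pole_series [:: n; n] z = E n.
Proof.
rewrite /pole_series !big_cons big_nil /= subrr mul0r subr0 addr0.
by field.
Qed.

Lemma pole_series3 a b c :
  pole_series [:: a; b; c] z = 2^-1 * (E a + E b + E c - E 1).
Proof.
rewrite /pole_series !big_cons big_nil /= addr0 !addrA.
by rewrite -[3%:R - 2](_ : 1 = _) ?mul1r // (natrD _ 1 2) addrK.
Qed.

Lemma exponent_prod_full n : (0 < n)%N ->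
  EP (iota 0 n.+1) n = (X - 2) * (X + 2) * ((z ^+ n - z ^- n) / (z - z^-1)).
Proof.
move=> n0; rewrite -exponent_prod_iota //.
have -> : iota 0 n.+1 = 0%N :: iota 1 n.-1 ++ [:: n].
  by case: n n0 => // k _; have := iotaD 1 k 1; rewrite addn1 add1n /= => ->.
rewrite exponent_prod_cons exponent_prod_cat exponent_prod_cons.
rewrite exponent_prod_nil joukowski_exp0 joukowski_exp_order // opprK mulr1.
by rewrite mulrAC mulrA.
Qed.

Let X2 : (X - 2) * (X + 2) = (z - z^-1) ^+ 2.
Proof. by rewrite /joukowski; field. Qed.

(** With u = (z^n - z^-n) / (z - 1/z), the affine product is (X^2 - 4) u^2 and the finite one is u
    (z^n + z^-n). *)
Lemma mckay_identityA n : (0 < n)%N ->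
  EP (aff_exponents (DynkinA (2 * n).-1)) (aff_coxeter (DynkinA (2 * n).-1)) *
    pole_series [:: n; n] z =
  EP (fin_exponents (DynkinA (2 * n).-1)) (fin_coxeter (DynkinA (2 * n).-1)).
Proof.
move=> n0; rewrite pole_series_cyclic /= prednK ?muln_gt0 //.
have -> : ((2 * n).-1./2 = n.-1)%N by lia.
rewrite prednK // exponent_prod_iota ?muln_gt0 //.
rewrite exponent_prod_cons !exponent_prod_cat !exponent_prod_iota //.
rewrite exponent_prod_cons exponent_prod_nil joukowski_exp0.
rewrite joukowski_exp_order // opprK mulr1.
have -> (u : R[i]) : (X - 2) * (u * (u * (X + 2))) = u ^+ 2 * ((X - 2) * (X +
  2)).
  by rewrite expr2; ring.
rewrite X2 /cyclic_series; have := @zB (n * 2) _;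
  rewrite muln_gt0 n0 => /(_ isT).
have := @zBV 1 isT; rewrite [(2 * n)%N]mulnC exprM !expr1 expr2.
have : z ^+ n != 0 by rewrite expf_neq0.
move: (z ^+ n) => y y0 zV y2; rewrite !expr2; move: z0 zV => nz0;
  set zi := z - z^-1 => zV.
by field; rewrite zV y0 y2.
Qed.

Lemma mckay_identityD n : (1 < n)%N ->
  EP (aff_exponents (DynkinD n.+2)) (aff_coxeter (DynkinD n.+2)) *
    pole_series [:: 2; 2; n] z =
  EP (fin_exponents (DynkinD n.+2)) (fin_coxeter (DynkinD n.+2)).
Proof.
move=> n1; have n0 := ltnW n1.
have -> : EP (fin_exponents (DynkinD n.+2)) (fin_coxeter (DynkinD n.+2)) =
          C n.+1 * X.
  rewrite -[fin_coxeter _]/(2 * n.+1)%N.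
  rewrite -[fin_exponents _]/(rcons [seq (2 * i).+1 | i <- iota 0 n.+1] n.+1).
  rewrite -cats1 exponent_prod_cat exponent_prod_odd //.
  rewrite exponent_prod_cons exponent_prod_nil joukowski_exp_half //.
  by rewrite subr0 mulr1.
have -> : EP (aff_exponents (DynkinD n.+2)) (aff_coxeter (DynkinD n.+2)) =
   (X - 2) * (X + 2) * ((z ^+ n - z ^- n) / (z - z^-1)) * X ^+ 2.
  rewrite -exponent_prod_full // /aff_exponents /aff_coxeter.
  rewrite -[n.+2./2]/(n./2.+1) -[odd n.+2]/(~~ ~~ odd n) negbK.
  case: ifP => odd_n.
    have -> : (2 * n./2.+1 - 1 = n)%N by lia.
    have -> : (2 * n./2.+1 = n.+1)%N by lia.
    rewrite exponent_prod_cat exponent_prod_scale //.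
    rewrite !exponent_prod_cons exponent_prod_nil joukowski_exp_half //.
    by rewrite subr0 mulr1.
  have -> : (2 * n./2.+1 - 1 = n.+1)%N by lia.
  have -> : (2 * n./2.+1 - 2 = n)%N by lia.
  have -> : (n./2.+1 - 1 = n./2)%N by lia.
  rewrite exponent_prod_cat !exponent_prod_cons exponent_prod_nil.
  have -> : X - joukowski (unity_exp R n ^+ n./2) = X.
    have {1}-> : (n = 2 * n./2)%N by lia.
    by rewrite joukowski_exp_half ?subr0 //; lia.
  by rewrite mulr1.
rewrite pole_series3 X2 /cyclic_series.
have := @zB (n * 2) _; rewrite muln_gt0 n0 => /(_ isT).
have := @zBV 1 isT; rewrite [(2 * n)%N]mulnC exprM !expr1 [z ^+ n.+1]exprS.
rewrite -[(2 * 2)%N]/4%N -[(2 * 1)%N]/2%N.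
have : z ^+ n != 0 by rewrite expf_neq0.
have := @zB 2 isT; have := @zB 4 isT; have := X_neq0; rewrite /joukowski.
move: (z ^+ n) => y X0 nz4 nz2 y0 zV y2.
by field; rewrite z0 y0 y2 nz4 -expr2 nz2.
Qed.

Local Notation U n := ((z ^+ n - z ^- n) / (z - z^-1)).

Let U_neq0 n : (0 < n)%N -> U n != 0.
Proof. by move=> n0; rewrite mulf_neq0 ?invr_eq0 ?zBV // -[z]expr1 -exprVn zBV.
  Qed.

(** [C n] and [U n] are Chebyshev polynomials in X, of the first and second kind up to scaling. The
    three exceptional cases thereby become identities between rational functions of X alone. *)
Let cyclic_seriesE n : (0 < n)%N -> E n = C n / ((X ^+ 2 - 4) * U n).
Proof.
move=> n0; have -> : X ^+ 2 - 4 = (z - z^-1) ^+ 2 by rewrite /joukowski; field.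
have := @zB (n * 2) _; rewrite muln_gt0 n0 => /(_ isT).
rewrite /cyclic_series [(2 * n)%N]mulnC exprM.
have := @zBV 1 isT; rewrite !expr1 !expr2;
  have : z ^+ n != 0 by rewrite expf_neq0.
move: (z ^+ n) (z - z^-1) => y d y0 d0 y2.
have yV : y - y^-1 != 0.
  by apply: contraNneq y2 => E0; rewrite -[1](mulfV y0) -mulrBr E0 mulr0.
by field; rewrite d0 y0 y2.
Qed.

Let X24 : X ^+ 2 - 4 != 0.
Proof.
have -> : X ^+ 2 - 4 = (z - z^-1) ^+ 2 by rewrite /joukowski; field.
by rewrite expf_neq0 // -[z]expr1 -exprVn zBV.
Qed.

Let zzV : z * z - 1 != 0. Proof. by rewrite -expr2 zB. Qed.
Let C2 : C 2 = X ^+ 2 - 2. Proof. by rewrite /joukowski; field. Qed.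
Let C3 : C 3 = X ^+ 3 - 3 * X. Proof. by rewrite /joukowski; field. Qed.
Let C4 : C 4 = X ^+ 4 - 4 * X ^+ 2 + 2. Proof. by rewrite /joukowski;
  field. Qed.
Let C5 : C 5 = X ^+ 5 - 5 * X ^+ 3 + 5 * X. Proof. by rewrite /joukowski;
  field. Qed.
Let U1 : U 1 = 1. Proof. by rewrite !expr1 divff // -[z]expr1 -exprVn zBV. Qed.
Let U2 : U 2 = X. Proof. by rewrite /joukowski; field; rewrite z0 zzV. Qed.
Let U3 : U 3 = X ^+ 2 - 1. Proof. by rewrite /joukowski; field;
  rewrite z0 zzV. Qed.
Let U4 : U 4 = X ^+ 3 - 2 * X. Proof. by rewrite /joukowski; field;
  rewrite z0 zzV. Qed.
Let U5 : U 5 = X ^+ 4 - 3 * X ^+ 2 + 1.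
Proof. by rewrite /joukowski; field; rewrite z0 zzV. Qed.

Let CX3 n : z ^+ (3 * n) + z ^- (3 * n) = C n ^+ 3 - 3 * C n.
Proof.
rewrite mulnC exprM; have : z ^+ n != 0 by rewrite expf_neq0.
by move: (z ^+ n) => y y0; field.
Qed.

Let EPodd n : (0 < n)%N -> EP [seq (2 * i).+1 | i <- iota 0 n] (2 * n) = C n.
Proof. by move=> n0; apply: exponent_prod_odd. Qed.

Let EPiota n : (0 < n)%N -> EP (iota 1 n.-1) n = U n.
Proof. by move=> n0; apply: exponent_prod_iota. Qed.

Let EP_ends n ms : (0 < n)%N -> EP (0%N :: n :: ms) n = (X ^+ 2 - 4) * EP ms n.
Proof.
move=> n0; rewrite !exponent_prod_cons joukowski_exp0 joukowski_exp_order //.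
by rewrite opprK mulrA; congr (_ * _); ring.
Qed.

Let EP_half n ms : (0 < n)%N -> EP (n :: ms) (2 * n) = X * EP ms (2 * n).
Proof. by move=> n0; rewrite exponent_prod_cons joukowski_exp_half ?subr0. Qed.

Let EP_nil n : EP [::] n = 1. Proof. exact: exponent_prod_nil. Qed.

(* The exponents of E6 together with 3, 9 are the odd numbers below 12 and 4, 8;
   similarly for E7 with 3, 9, 15 added, and E8 with 3, 9, 15, 21, 27, 5, 15,
     25. *)
Lemma mckay_identityE6 :
  EP (aff_exponents DynkinE6) 6 * pole_series [:: 2; 3; 3] z =
  EP (fin_exponents DynkinE6) 12.
Proof.
have -> : EP (aff_exponents DynkinE6) 6 = (X ^+ 2 - 4) * (X * (U 3 * U 3)).
  pose s := [seq (2 * i)%N | i <- iota 1 2].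
  rewrite (@exponent_prod_perm _ _ [:: 0, 6, 3 & s ++ s]%N) // EP_ends //.
  by rewrite (@EP_half 3) // exponent_prod_cat (@exponent_prod_scale _ 2 _ 3)
    // (@EPiota 3).
have -> : EP (fin_exponents DynkinE6) 12 = (C 2 ^+ 2 - 3) * U 3.
  have C2E : EP [:: 3; 9]%N 12 = C 2.
    exact: etrans (exponent_prod_scale [:: 1;
      3]%N z (isT : 0 < 3)%N (isT : 0 < 4)%N) (@EPodd 2 isT).
  have U3E : EP [:: 4; 8]%N 12 = U 3.
    exact: etrans (exponent_prod_scale [:: 1;
      2]%N z (isT : 0 < 4)%N (isT : 0 < 3)%N) (@EPiota 3 isT).
  have C6E : EP [:: 1; 3; 5; 7; 9; 11]%N 12 = C (3 * 2) by apply: (@EPodd 6).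
  have : EP (fin_exponents DynkinE6) 12 * EP [:: 3; 9]%N 12 =
      EP [:: 1; 3; 5; 7; 9; 11]%N 12 * EP [:: 4; 8]%N 12.
    by rewrite -!exponent_prod_cat; apply: exponent_prod_perm.
  rewrite C2E U3E C6E CX3 => eq_fin; apply: (mulIf (@C_neq0 2 isT));
    rewrite eq_fin.
  by move: (C 2) (U 3) => c u; ring.
rewrite pole_series3 !cyclic_seriesE // U1 C2 C3 U2 U3 -[C 1]/X.
have := @U_neq0 3 isT; rewrite U3; move: X X_neq0 X24 => x x0 x2 x3.
by field; rewrite x0 x2 x3.
Qed.

Lemma mckay_identityE7 :
  EP (aff_exponents DynkinE7) 12 * pole_series [:: 2; 3; 4] z =
  EP (fin_exponents DynkinE7) 18.
Proof.
have -> : EP (aff_exponents DynkinE7) 12 = (X ^+ 2 - 4) * (X * (X * (U 3 * C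
  2))).
  pose s := [seq (4 * i)%N | i <- iota 1 2].
  pose s' := [seq (3 * i)%N | i <- [seq (2 * i).+1 | i <- iota 0 2]].
  rewrite (@exponent_prod_perm _ _ [:: 0, 12, 6, 6 & s ++ s']%N) // EP_ends //.
  rewrite !(@EP_half 6) // exponent_prod_cat (@exponent_prod_scale _ 4 _ 3) //.
  by rewrite (@EPiota 3) // (@exponent_prod_scale _ 3 _ 4) // (@EPodd 2).
have -> : EP (fin_exponents DynkinE7) 18 = (C 3 ^+ 2 - 3) * X.
  have C3E : EP [:: 3; 9; 15]%N 18 = C 3.
    exact: etrans (exponent_prod_scale [:: 1; 3;
      5]%N z (isT : 0 < 3)%N (isT : 0 < 6)%N) (@EPodd 3 isT).
  have C9E : EP [:: 1; 3; 5; 7; 9; 11; 13; 15;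
    17]%N 18 = C (3 * 3) by apply: (@EPodd 9).
  have XE : EP [:: 9]%N 18 = X.
    by rewrite (@EP_half 9) // EP_nil mulr1.
  have : EP (fin_exponents DynkinE7) 18 * EP [:: 3; 9; 15]%N 18 =
      EP [:: 1; 3; 5; 7; 9; 11; 13; 15; 17]%N 18 * EP [:: 9]%N 18.
    by rewrite -!exponent_prod_cat; apply: exponent_prod_perm.
  rewrite C3E C9E XE CX3 => eq_fin; apply: (mulIf (@C_neq0 3 isT));
    rewrite eq_fin.
  by move: (C 3) X => c x; ring.
rewrite pole_series3 !cyclic_seriesE // U1 C2 C3 C4 U2 U3 U4 -[C 1]/X.
have := @U_neq0 3 isT; have := @U_neq0 4 isT; rewrite U3 U4.
move: X X_neq0 X24 => x x0 x2 x4 x3.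
by field; rewrite x0 x2 x3 x4.
Qed.

Lemma mckay_identityE8 :
  EP (aff_exponents DynkinE8) 30 * pole_series [:: 2; 3; 5] z =
  EP (fin_exponents DynkinE8) 30.
Proof.
have -> : EP (aff_exponents DynkinE8) 30 = (X ^+ 2 - 4) * (X * (U 3 * U 5)).
  pose s := [seq (10 * i)%N | i <- iota 1 2].
  pose s' := [seq (6 * i)%N | i <- iota 1 4].
  rewrite (@exponent_prod_perm _ _ [:: 0, 30, 15 & s ++ s']%N) // EP_ends //.
  rewrite (@EP_half 15) // exponent_prod_cat (@exponent_prod_scale _ 10 _ 3) //.
  by rewrite (@EPiota 3) // (@exponent_prod_scale _ 6 _ 5) // (@EPiota 5).
have nz35 := mulf_neq0 (@C_neq0 3 isT) (@C_neq0 5 isT).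
(* The number 15 is an odd multiple of both 3 and 5, hence the additional factor X. *)
have eq_fin : EP (fin_exponents DynkinE8) 30 * (C 3 * C 5) = (C 5 ^+ 3 - 3 * C
  5) * X.
  have C3E : EP [:: 5; 15; 25]%N 30 = C 3.
    exact: etrans (exponent_prod_scale [:: 1; 3;
      5]%N z (isT : 0 < 5)%N (isT : 0 < 6)%N) (@EPodd 3 isT).
  have C5E : EP [:: 3; 9; 15; 21; 27]%N 30 = C 5.
    exact: etrans (exponent_prod_scale [:: 1; 3; 5; 7;
      9]%N z (isT : 0 < 3)%N (isT : 0 < 10)%N) (@EPodd 5 isT).
  pose s := [seq (2 * i).+1 | i <- iota 0 15].
  have C15E : EP s 30 = C (3 * 5) by apply: (@EPodd 15).
  have XE : EP [:: 15]%N 30 = X by rewrite (@EP_half 15) // EP_nil mulr1.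
  have : EP (fin_exponents DynkinE8) 30 *
      (EP [:: 5; 15; 25]%N 30 * EP [:: 3; 9; 15; 21; 27]%N 30) =
      EP s 30 * EP [:: 15]%N 30.
    by rewrite -!exponent_prod_cat; apply: exponent_prod_perm.
  by rewrite C3E C5E C15E XE CX3.
apply: (mulIf nz35); rewrite eq_fin.
rewrite pole_series3 !cyclic_seriesE // U1 C2 C3 C5 U2 U3 U5 -[C 1]/X.
have := @U_neq0 3 isT; have := @U_neq0 5 isT; rewrite U3 U5.
move: X X_neq0 X24 => x x0 x2 x5 x3.
by field; rewrite x0 x2 x3 x5.
Qed.

End McKayIdentities.

Lemma mulmx_sqr22 (F : comNzRingType) (M : 'M[F]_2) :
  M *m M = \tr M *: M - (\det M)%:M.
Proof.
apply/matrixP => i j.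
rewrite /mxtrace (expand_det_row _ 0) !big_ord_recl !big_ord0 /cofactor
  !det_mx11 !mxE.
rewrite !big_ord_recl !big_ord0 /=.
have -> : lift 0 0 = 1 :> 'I_2 by apply/val_inj.
have -> : lift 1 0 = 0 :> 'I_2 by apply/val_inj.
have i01 (k : 'I_2) : k = 0 \/ k = 1.
  by case: k => [[|[|k]] lt_k2]; [left|right|]; try apply/val_inj.
by case: (i01 i) (i01 j) => -> [] ->; rewrite /= ?mulr1n ?mulr0n /bump /=; ring.
Qed.

Lemma det_sub_scalar22 (F : comNzRingType) (M : 'M[F]_2) (a : F) :
  \det (M - a%:M) = a ^+ 2 - \tr M * a + \det M.
Proof.
rewrite /mxtrace !(expand_det_row _ 0) !big_ord_recl !big_ord0 /cofactor
  !det_mx11 !mxE.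
have -> : lift 0 0 = 1 :> 'I_2 by apply/val_inj.
have -> : lift 1 0 = 0 :> 'I_2 by apply/val_inj.
by rewrite /= ?mulr1n ?mulr0n /bump /=; ring.
Qed.

(** * Centralizers in finite subgroups of SL_2 *)

Section SL2Subgroup.
Variables (F : numClosedFieldType) (gT : finGroupType) (G : {group gT}).
Variable V : mx_representation F G 2.
Hypotheses (fV : mx_faithful V) (detV : {in G, forall g, \det (V g) = 1}).
Local Notation Z := (rcenter V).

Lemma rcenterP g : reflect (g \in G /\ exists a, V g = a%:M) (g \in Z).
Proof.
rewrite inE; apply: (iffP andP) => [[Gg /is_scalar_mxP] | [Gg /is_scalar_mxP]];
  by split.
Qed.

(** By Cayley-Hamilton N = V g - 1 has square 0, so the k-th power of V g is 1 + k N; finite order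
    and characteristic 0 force N = 0. *)
Lemma unipotent_eq1 g : g \in G -> \tr (V g) = 2 -> g = 1%g.
Proof.
move=> Gg tr2; apply: (mx_faithful_inj fV) => //; rewrite repr_mx1.
pose N := V g - 1; have NN : N * N = 0.
  have VV : V g * V g = V g + V g - 1.
    by rewrite -[LHS]/(V g *m V g) mulmx_sqr22 tr2 detV // scaler_nat mulr2n.
  by rewrite mulrBr mulr1 mulrBl mul1r VV [_ - V g]addrAC addrK subrr.
have VgX k : V g ^+ k = 1 + N *+ k.
  elim: k => [|k IHk]; first by rewrite expr0 mulr0n addr0.
  rewrite exprS IHk -[V g](subrK 1) -/N addrC mulrDl mul1r mulrDr mulr1.
  by rewrite mulrnAr NN mul0rn addr0 mulrSr [RHS]addrA.
have := VgX #[g]; rewrite -repr_mxX // expg_order repr_mx1.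
move/eqP; rewrite -[1%:M]/(1 : 'M_2) -subr_eq0 opprD addrA subrr sub0r oppr_eq0.
rewrite -scaler_nat scalemx_eq0 pnatr_eq0 -leqn0 leqNgt order_gt0 /= subr_eq0.
by move/eqP.
Qed.

(** A noncentral [x] has a line as eigenspace, and its centralizer preserves this line; [e g] is the
    scalar by which [g] acts on it. The other eigenvalue is 1 / e g because the determinant is 1,
    and [unipotent_eq1] makes [e] injective. *)
Lemma centralizer_eigenvalue x : x \in G :\: Z -> exists e : gT -> F,
  [/\ {in 'C_G[x] &, {morph e : g h / (g * h)%g >-> g * h}},
      {in 'C_G[x], forall g k, e (g ^+ k)%g = e g ^+ k},
      {in 'C_G[x] &, injective e} &
      {in 'C_G[x], forall g, e g != 0 /\ \tr (V g) = joukowski (e g)}].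
Proof.
rewrite inE => /andP[nZx Gx]; have [a /eigenvalueP[v va v0]] :=
  eigenvalue_closed (V x) isT.
have sE_v u : u *m V x = a *: u -> exists k, u = k *: v.
  move=> ua; apply/sub_rVP.
  have rE : \rank (eigenspace (V x) a) = 1%N.
    apply/eqP; rewrite eqn_leq; apply/andP; split; last first.
      have /mxrankS : (v <= eigenspace (V x) a)%MS by apply/eigenspaceP.
      by rewrite rank_rV v0.
    rewrite leqNgt; apply: contra nZx => rk2; apply/rcenterP; split=> //.
    exists a; have : row_full (eigenspace (V x) a).
      by rewrite /row_full eqn_leq rank_leq_col.
    rewrite -sub1mx => /eigenspaceP; rewrite mul1mx => ->.
    by rewrite scalemx1.
  have vE : (v <= eigenspace (V x) a)%MS by apply/eigenspaceP.
  have uE : (u <= eigenspace (V x) a)%MS by apply/eigenspaceP.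
  apply: submx_trans uE _; have [_ <-] := mxrank_leqif_sup vE.
  by rewrite rE rank_rV v0.
have /rV0Pn[i vi] := v0.
pose e g := (v *m V g) 0 i / v 0 i.
have vV g : g \in 'C_G[x] -> v *m V g = e g *: v.
  case/setIP => Gg /cent1P cxg; have [|k Ek] := sE_v (v *m V g).
    by rewrite -mulmxA -repr_mxM // cxg repr_mxM // mulmxA va -scalemxAl.
  by rewrite /e Ek mxE mulfK.
have eM : {in 'C_G[x] &, {morph e : g h / (g * h)%g >-> g * h}}.
  move=> g h Cg Ch; have [[Gg _] [Gh _]] := (setIP Cg, setIP Ch).
  by rewrite {1}/e repr_mxM // mulmxA vV // -scalemxAl vV // !mxE mulrA mulfK.
have e_tr g : g \in 'C_G[x] -> e g != 0 /\ \tr (V g) = joukowski (e g).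
  move=> Cg; have [Gg _] := setIP Cg.
  have : \det (V g - (e g)%:M) = 0.
    apply/eqP/det0P; exists v => //;
      rewrite mulmxBr vV // mul_mx_scalar subrr //.
  rewrite det_sub_scalar22 detV // => E.
  have e0 : e g != 0.
    by apply: contra_eq_neq E => ->; rewrite expr0n mulr0 subrr add0r oner_neq0.
  split=> //; apply: (mulIf e0); rewrite /joukowski mulrDl mulVf //.
  by apply/eqP; rewrite -subr_eq0 -oppr_eq0 -E; apply/eqP; ring.
have e1 : e 1%g = 1 by rewrite /e repr_mx1 mulmx1 divff.
have eX : {in 'C_G[x], forall g k, e (g ^+ k)%g = e g ^+ k}.
  move=> g Cg; elim=> [|k IHk]; first by rewrite expg0 e1.
  by rewrite expgS exprS -IHk eM // groupX.
exists e; split=> // g h Cg Ch eq_e.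
have [[Gg _] [Gh _]] := (setIP Cg, setIP Ch).
have CgV : (g * h^-1)%g \in 'C_G[x] by rewrite groupM ?groupV.
have [_ tr_gV] := e_tr _ CgV.
apply/eqP; rewrite eq_mulgV1; apply/eqP; apply: unipotent_eq1.
  by rewrite groupM ?groupV.
by rewrite tr_gV eM ?groupV // eq_e -eM ?groupV // mulgV e1 /joukowski invr1.
Qed.

Lemma rcenter_cent x y : x \in Z -> y \in G -> commute x y.
Proof.
move=> /rcenterP[Gx [a Va]] Gy; apply: (mx_faithful_inj fV); rewrite ?groupM //.
by rewrite !repr_mxM // Va scalar_mxC.
Qed.

Lemma rcenter_sub_cent1 x : x \in G -> Z \subset 'C_G[x].
Proof.
move=> Gx; apply/subsetP => y Zy; rewrite inE; case/rcenterP: (Zy) => -> _ /=.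
by apply/cent1P; apply: rcenter_cent.
Qed.

Lemma cent1_cyclic x : x \in G :\: Z -> cyclic 'C_G[x].
Proof.
case/centralizer_eigenvalue => e [eM eX e_inj _].
have e1 : e 1%g = 1 := eX 1%g (group1 _) 0%N.
apply: (field_mul_group_cyclic eM) => u Cu; split=> [eu1|->//].
by apply: e_inj; rewrite ?group1 // e1.
Qed.

(** Centralizers of noncentral elements are abelian, which gives both inclusions. Consequently two
    of them that differ meet only in the center. *)
Lemma cent1_eq x y : x \in G :\: Z -> y \in 'C_G[x] -> y \notin Z ->
  'C_G[y] = 'C_G[x].
Proof.
have sub u v : u \in G :\: Z -> v \in 'C_G[u] -> 'C_G[u] \subset 'C_G[v].
  move=> nZu Cv; apply/subsetP => g Cg; have [Gg _] := setIP Cg.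
  rewrite inE Gg; apply/cent1P.
  exact: (centsP (cyclic_abelian (cent1_cyclic nZu))).
move=> nZx Cy nZy; have [[Gx _] [Gy cxy]] := (setDP nZx, setIP Cy).
have nZGy : y \in G :\: Z by rewrite inE nZy.
have Cx : x \in 'C_G[y] by rewrite inE Gx cent1C.
by apply/eqP; rewrite eqEsubset !sub.
Qed.

Lemma rcenter_sqr c : c \in Z -> (c * c = 1)%g.
Proof.
case/rcenterP=> Gc [a Va]; apply: (mx_faithful_inj fV); rewrite ?groupM //.
rewrite repr_mxM // repr_mx1 Va -scalar_mxM.
by have := detV Gc; rewrite Va det_scalar expr2 => ->.
Qed.

(** Conjugation preserves the trace, so it maps the eigenvalue of a noncentral c to itself or to its
    inverse. In the first case y commutes with c and lies in 'C_G[c] = 'C_G[x]. *)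
Lemma cent1_norm_inv x y c : x \in G :\: Z -> y \in 'N_G('C_G[x]) ->
  y \notin 'C_G[x] -> c \in 'C_G[x] -> (c ^ y)%g = c^-1%g.
Proof.
move=> nZx /setIP[Gy nCy] nCyx Cc; have [Gc _] := setIP Cc.
have [Zc | nZc] := boolP (c \in Z).
  rewrite /conjg (rcenter_cent Zc Gy) mulKg; apply/eqP.
  by rewrite eq_sym eq_invg_mul rcenter_sqr.
have Ccy : (c ^ y)%g \in 'C_G[x] by rewrite memJ_norm.
have [e [eM eX e_inj e_tr]] := centralizer_eigenvalue nZx.
have [[e0 tr_c] [ey0 tr_cy]] := (e_tr c Cc, e_tr _ Ccy).
have /eqP : joukowski (e (c ^ y)%g) - joukowski (e c) = 0.
  by rewrite -tr_c -tr_cy mxtrace_conj // subrr.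
rewrite joukowskiB // !mulf_eq0 invr_eq0 (negPf ey0) orbF !subr_eq0.
case/orP => /eqP E; last first.
  apply: e_inj; rewrite ?groupV //; apply: (mulfI e0); rewrite E mulfV //.
  by rewrite -eM ?groupV // mulgV (eX 1%g (group1 _) 0%N).
case/negP: nCyx; rewrite -(cent1_eq nZx Cc nZc) inE Gy /=.
by rewrite cent1C; apply/cent1P/commgP/conjg_fixP/e_inj.
Qed.

(** Two elements of the normaliser outside the centralizer both invert it, so their quotient
    commutes with x. *)
Lemma cent1_index x : x \in G :\: Z ->
  #|'N_G('C_G[x]) : 'C_G[x]| = 1%N \/ #|'N_G('C_G[x]) : 'C_G[x]| = 2%N.
Proof.
move=> nZx; have Gx : x \in G by case/setDP: nZx.
have sCN : 'C_G[x] \subset 'N_G('C_G[x]) by rewrite subsetI subsetIl normG.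
have [sNC | /subsetPn[y Ny nCy]] := boolP ('N_G('C_G[x]) \subset 'C_G[x]).
  by left; apply/eqP; rewrite indexg_eq1.
right; apply/eqP; rewrite eqn_leq; apply/andP; split; last first.
  rewrite ltn_neqAle eq_sym indexg_eq1 indexg_gt0 andbT.
  by apply/subsetPn; exists y.
have sN : 'N_G('C_G[x]) \subset 'C_G[x] :|: 'C_G[x] :* y.
  apply/subsetP => u Nu; rewrite inE; have [//|nCu /=] := boolP (u \in _).
  have Cx : x \in 'C_G[x] by rewrite inE Gx; apply/cent1P.
  have nCyV : y^-1%g \notin 'C_G[x] by rewrite groupV.
  rewrite mem_rcoset inE groupM ?groupV ?(subsetP (subsetIl _ _) _ Nu)
     ?(subsetP (subsetIl _ _) _ Ny) //=.
  rewrite cent1C; apply/cent1P/commgP/conjg_fixP;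
    rewrite conjgM (cent1_norm_inv nZx Nu) //.
  by rewrite (cent1_norm_inv nZx _ nCyV) ?groupV // invgK.
rewrite -(leq_pmul2l (cardG_gt0 'C_G[x])) Lagrange // (leq_trans
  (subset_leq_card sN)) //.
rewrite muln2 -addnn -[X in (_ <= _ + X)%N](card_rcoset _ y);
  exact: leq_card_setU.
Qed.

Section EvenOrder.
Hypothesis evenG : ~~ odd #|G|.

(** Cayley-Hamilton reads tr(V t) V t = 2, so the trace is nonzero and V t is scalar. *)
Lemma involution_rcenter t : t \in G -> (t * t = 1)%g -> t \in Z.
Proof.
move=> Gt tt; apply/rcenterP; split=> //; exists (2 / \tr (V t)).
have /eqP := mulmx_sqr22 (V t).
rewrite -repr_mxM // tt repr_mx1 detV // eq_sym subr_eq -raddfD /= => /eqP E.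
have tr0 : \tr (V t) != 0.
  apply: contra_eq_neq E => ->; rewrite scale0r eq_sym -scalemx1 scalemx_eq0.
  by rewrite negb_or -[1 + 1]/(2%:R : F) pnatr_eq0; apply: (oner_neq0 'M[F]_2).
move/(congr1 ( *:%R (\tr (V t))^-1)): E.
by rewrite scalerA mulVf // scale1r scale_scalar_mx mulrC.
Qed.

Lemma rcenter_even : exists z, [/\ z \in G, V z = -1%:M, Z = [set 1%g;
  z] & #|Z| = 2%N].
Proof.
have [|t Gt ot] := @Cauchy _ 2 G isT; first by rewrite dvdn2.
have tt : (t * t = 1)%g by rewrite -[RHS](expg_order t) ot expgS expg1.
have t1 : t != 1%g by rewrite -order_eq1 ot.
have sgnZ c : c \in Z -> V c = 1%:M \/ V c = -1%:M.
  case/rcenterP=> Gc [a Va]; have /eqP := detV Gc.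
  rewrite Va det_scalar sqrf_eq1 => /orP[/eqP-> | /eqP->]; first by left.
  by right; rewrite raddfN.
have Zt := involution_rcenter Gt tt.
have Vt : V t = -1%:M.
  case: (sgnZ t Zt) => // Vt; case/eqP: t1; apply: (mx_faithful_inj fV) => //.
  by rewrite repr_mx1.
have defZ : Z = [set 1%g; t].
  apply/setP=> c; apply/idP/set2P => [Zc | [-> | ->]]; rewrite ?group1 //.
  have Gc : c \in G by case/rcenterP: Zc.
  case: (sgnZ c Zc) => Vc; [left | right]; apply: (mx_faithful_inj fV) => //.
    by rewrite repr_mx1.
  by rewrite Vt.
by exists t; split; rewrite // defZ cards2 eq_sym t1.
Qed.

(** The square of y centralizes x; were it noncentral, its centralizer, which contains y, would be
    'C_G[x]. So it is 1 or z, and 1 is excluded because involutions are central. *)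
Lemma cent1_norm_sqr x y z : x \in G :\: Z -> y \in 'N_G('C_G[x]) ->
  y \notin 'C_G[x] -> z \in G -> V z = -1%:M -> (y * y = z)%g.
Proof.
move=> nZx Ny nCy Gz Vz; have [[Gx _] [Gy _]] := (setDP nZx, setIP Ny).
have [t [Gt Vt defZ _]] := rcenter_even.
have <- : t = z by apply: (mx_faithful_inj fV); rewrite // Vt Vz.
have nZy : y \notin Z by apply: contra nCy;
  apply: (subsetP (rcenter_sub_cent1 Gx)).
have Cyy : (y * y)%g \in 'C_G[x].
  rewrite inE groupM // cent1C; apply/cent1P/commgP/conjg_fixP.
  have Cx : x \in 'C_G[x] by rewrite inE Gx; apply/cent1P.
  rewrite conjgM (cent1_norm_inv nZx Ny) // (cent1_norm_inv nZx Ny) ?groupV //.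
  exact: invgK.
have [|nZyy] := boolP ((y * y)%g \in Z).
  rewrite defZ !inE => /orP[/eqP yy | /eqP //].
  by case/negP: nZy; apply: involution_rcenter.
case/negP: nCy; rewrite -(cent1_eq nZx Cyy nZyy) inE Gy; apply/cent1P.
exact: commuteM.
Qed.

End EvenOrder.

End SL2Subgroup.

(** * Pole orders and the axes of the rotation group *)

Lemma leq_mul_divn k n N : (k <= n)%N -> (n %| N)%N -> (k * (N %/ n) <= N)%N.
Proof. by move=> le_kn dvN; rewrite -{2}(divnK dvN) mulnC leq_mul2l le_kn orbT.
  Qed.

(** The terms 1 - 1/n are at least 1/2 and their sum is below 2, so there are at most three. Sorted,
    three orders begin with 2; the next is 2 or 3, and after 2, 3 the last is below 6. Everything is
    multiplied by N to stay in integer arithmetic. *)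
Lemma pole_orders_classification (N : nat) (L : seq nat) : (0 < N)%N ->
    all (fun n => (1 < n)%N && (n %| N)%N) L ->
    2 * (N%:Z - 1) = \sum_(n <- L) (N%:Z - (N %/ n)%N%:Z) ->
  [\/ N = 1%N, perm_eq L [:: N; N],
      exists2 n, N = (2 * n)%N & perm_eq L [:: 2; 2; n]%N |
      [\/ N = 12 /\ perm_eq L [:: 2; 3; 3]%N, N = 24 /\ perm_eq L [:: 2; 3;
        4]%N |
        N = 60 /\ perm_eq L [:: 2; 3; 5]%N]%N].
Proof.
move=> N0 allL sumL.
have permL : perm_eq L (sort leq L) by rewrite perm_sym perm_sort.
have sL : sorted leq (sort leq L) by apply: sort_sorted; apply: leq_total.
move: allL sumL; rewrite (perm_all _ permL) (perm_big _ permL) /=.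
case: (sort leq L) permL sL => [|a [|b [|c [|d l]]]] permL /= sL allL;
  rewrite ?big_cons ?big_nil /=.
- by move=> E; apply: Or41; lia.
- case/andP: allL => /andP[a1 aN] _ E.
  by have := leq_mul_divn a1 aN; have := divnK aN; case: (N %/ a)%N E => //;
    lia.
- case/and3P: allL => /andP[a1 aN] /andP[b1 bN] _ E.
  have := leq_mul_divn a1 aN; have := leq_mul_divn b1 bN.
  move: (divnK aN) (divnK bN) E; case: (N %/ a)%N => [|x]; first lia.
  case: (N %/ b)%N => [|y]; first lia.
  move=> Na Nb E _ _; have [x0 y0] : x = 0%N /\ y = 0%N by lia.
  by apply: Or42; move: Na Nb permL; rewrite x0 y0 !mul1n => -> ->.
- case/and4P: allL => /andP[a1 aN] /andP[b1 bN] /andP[c1 cN] _ E.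
  case/and3P: sL => ab bc _.
  have a2 : a = 2%N.
    apply/eqP; rewrite eqn_leq a1 andbT leqNgt; apply/negP => a3.
    have := leq_mul_divn a3 aN; have := leq_mul_divn (leq_trans a3 ab) bN.
    have := leq_mul_divn (leq_trans a3 (leq_trans ab bc)) cN; lia.
  subst a; have E2 := divnK aN.
  have [b4 | b4] := leqP 4 b.
    have := leq_mul_divn b4 bN.
    by have := leq_mul_divn (leq_trans b4 bc) cN; lia.
  have E3 := divnK bN; have Ec := divnK cN.
  have [b2 | b3] : b = 2%N \/ b = 3%N by lia.
    subst b.
    have cu : (N %/ c)%N = 2%N by lia.
    by apply: Or43; exists c => //; lia.
  subst b.
  have c6 : (c < 6)%N.
    by rewrite ltnNge; apply/negP => c6; have := leq_mul_divn c6 cN; lia.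
  apply: Or44; have : c = 3%N \/ c = 4%N \/ c = 5%N by lia.
  by case=> [|[]] cE; subst c;
    [apply: Or31 | apply: Or32 | apply: Or33]; split=> //; lia.
case/and5P: allL => /andP[a1 aN] /andP[b1 bN] /andP[c1 cN] /andP[d1 dN] lN.
set S := \sum_(j <- l) _ => E; exfalso.
have := leq_mul_divn a1 aN; have := leq_mul_divn b1 bN.
have := leq_mul_divn c1 cN; have := leq_mul_divn d1 dN.
have : 0 <= S.
  by apply: sumr_ge0 => j _; rewrite subr_ge0 lez_nat leq_div.
move: S E; lia.
Qed.

Section CentralizerFamily.
Variables (F : numClosedFieldType) (gT : finGroupType) (G : {group gT}).
Variable V : mx_representation F G 2.
Hypotheses (fV : mx_faithful V) (detV : {in G, forall g, \det (V g) = 1}).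
Local Notation Z := (rcenter V).

(** These are the axes: each member is the inverse image of the group of all rotations about one
    axis. *)
Definition cent1_family : {set {set gT}} := [set 'C_G[x] | x in G :\: Z].
Local Notation M := cent1_family.

Lemma cent1_familyP C y : C \in M -> y \in C -> y \notin Z ->
  y \in G :\: Z /\ C = 'C_G[y].
Proof.
case/imsetP=> x nZx -> Cy nZy; have [Gy _] := setIP Cy.
split; first by apply/setDP.
by rewrite (cent1_eq fV detV nZx Cy nZy).
Qed.

Lemma sum_cent1_family (W : nmodType) (phi : gT -> W) :
  \sum_(g in G) phi g =
    \sum_(g in Z) phi g + \sum_(C in M) \sum_(g in C :\: Z) phi g.
Proof.
have sZG : Z \subset G by apply/subsetP=> g /rcenterP[].
rewrite (big_setID Z) /= (setIidPr sZG); congr (_ + _).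
rewrite (partition_big (fun g => 'C_G[g]) (mem M)) /=; last first.
  by move=> g nZg; apply: imset_f.
apply: eq_bigr => C MC; apply: eq_bigl => g; apply/andP/setDP.
  case=> nZg /eqP <-; have [Gg nZ] := setDP nZg; split=> //.
  by rewrite inE Gg; apply/cent1P.
by case=> Cg nZg; have [? <-] := cent1_familyP MC Cg nZg.
Qed.

Lemma cent1_familyJ C g : g \in G -> C \in M -> C :^ g \in M.
Proof.
move=> Gg /imsetP[x /setDP[Gx nZx] ->].
apply/imsetP; exists (x ^ g)%g; last by rewrite conjIg conjGid // cent1J.
apply/setDP; split; first exact: groupJ.
by apply: contra nZx; rewrite memJ_norm // (subsetP (normal_norm
  (rcenter_normal V))).
Qed.

(* L has one entry for each orbit of poles: an axis C has two poles, which are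
   conjugate when #|N_G(C) : C| = 2 and lie in different orbits otherwise. *)
Lemma pole_list : exists L : seq nat,
  [/\ {in L, forall n, exists2 C, C \in M & #|C| = (#|Z| * n)%N},
      {in M, forall C : {set gT}, exists2 n, n \in L & #|C| = (#|Z| * n)%N} &
      forall (W : nmodType) (phi : nat -> W),
        (\sum_(C in M) phi #|C|) *+ 2 =
          \sum_(n <- L) phi (#|Z| * n)%N *+ (#|G : Z| %/ n)].
Proof.
pose Om := orbit 'Js G @: M; pose rep (B : {set {set gT}}) := odflt set0 [pick
  C in B].
have actM : [acts G, on M | 'Js].
  apply/subsetP => g Gg; rewrite !inE; apply/subsetP => C MC; rewrite inE.
  exact: cent1_familyJ.
have parM := orbit_partition actM.
have repP B : B \in Om -> rep B \in M /\ B = orbit 'Js G (rep B).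
  case/imsetP=> C MC ->; rewrite /rep; case: pickP => [D | /(_ C)]; last first.
    by rewrite orbit_refl.
  move=> CD; rewrite -(orbit_eqP CD) /=; split=> //.
  by case/orbitP: CD => g Gg <-; apply: cent1_familyJ.
pose n_ (C : {set gT}) := (#|C| %/ #|Z|)%N;
  pose f_ (C : {set gT}) := (2 %/ #|'N_G(C) : C|)%N.
have n_P C : C \in M -> #|C| = (#|Z| * n_ C)%N.
  case/imsetP=> x /setDP[Gx _] ->; rewrite mulnC divnK //.
  by rewrite cardSg // rcenter_sub_cent1.
pose L := flatten [seq nseq (f_ (rep B)) (n_ (rep B)) | B <- enum Om].
have memL n : reflect (exists2 C, C \in M & n = n_ C) (n \in L).
  apply: (iffP flatten_mapP) => [[B] | [C MC ->]].
    rewrite mem_enum => /repP[MC _]; rewrite mem_nseq => /andP[_ /eqP->].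
    by exists (rep B).
  have OmC : orbit 'Js G C \in Om by apply: imset_f.
  exists (orbit 'Js G C); rewrite ?mem_enum //; have [MC' eqB] := repP _ OmC.
  have : C \in orbit 'Js G (rep (orbit 'Js G C)) by rewrite -eqB orbit_refl.
  case/orbitP=> g Gg; move: (rep _) MC' => D MD <-.
  rewrite mem_nseq /n_ cardJg eqxx andbT /f_.
  case/imsetP: MD => x nZx ->.
  by case: (cent1_index fV detV nZx) => ->.
exists L; split=> [n /memL[C MC ->] | C MC | W phi].
- by exists C; rewrite // -n_P.
- by exists (n_ C); [apply/memL; exists C | apply: n_P].
rewrite -(cover_partition parM) big_trivIset ?(partition_trivIset parM) //=.
rewrite big_flatten big_map big_enum /= -sumrMnl; apply: eq_bigr => B OmB.
have [MC eqB] := repP B OmB.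
rewrite big_nseq iter_addr_0 -n_P // (eq_bigr (fun=> phi #|rep B|)); last first.
  by move=> C; rewrite {1}eqB => /orbitP[g _ <-]; rewrite cardJg.
rewrite sumr_const -!mulrnA; congr (_ *+ _).
(* Here #|G : Z| %/ n is #|G : C|, that is #|G : N_G(C)| times #|N_G(C) : C|, and the last factor
   times [f_ C] is 2. *)
rewrite {1}eqB card_orbit astab1Js /f_; have := n_P _ MC.
case/imsetP: MC => x nZx ->; have Gx : x \in G by case/setDP: nZx.
have sZC := rcenter_sub_cent1 fV Gx.
rewrite -(Lagrange sZC) => /eqP; rewrite eqn_pmul2l // => /eqP <-.
rewrite -(Lagrange_index (subsetIl _ _) sZC) mulnK //.
have sCN : 'C_G[x] \subset 'N_G('C_G[x]) by rewrite subsetI subsetIl normG.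
rewrite -(Lagrange_index (subsetIl _ _) sCN) -mulnA; congr (_ * _)%N.
by case: (cent1_index fV detV nZx) => ->.
Qed.

Lemma rcenter_sub : Z \subset G. Proof. by apply/subsetP=> g /rcenterP[]. Qed.

Lemma cent1_family_sub C : C \in M -> Z \subset C.
Proof. by case/imsetP=> x /setDP[Gx _] ->; apply: rcenter_sub_cent1. Qed.

Section PoleList.
Variable L : seq nat.
Hypotheses
  (LM : {in L, forall n, exists2 C, C \in M & #|C| = (#|Z| * n)%N})
  (sumL : forall (W : nmodType) (phi : nat -> W),
        (\sum_(C in M) phi #|C|) *+ 2 =
          \sum_(n <- L) phi (#|Z| * n)%N *+ (#|G : Z| %/ n)).

Lemma pole_order_gt1 n : n \in L -> (1 < n)%N /\ (n %| #|G : Z|)%N.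
Proof.
case/LM => C /imsetP[x nZx ->] cardC; have Gx : x \in G by case/setDP: nZx.
have sZC := rcenter_sub_cent1 fV Gx.
move/eqP: cardC; rewrite -(Lagrange sZC) eqn_pmul2l // => /eqP <-.
split; last by rewrite -(Lagrange_index (subsetIl _ _) sZC) dvdn_mull.
rewrite ltn_neqAle eq_sym indexg_eq1 indexg_gt0 andbT.
apply/subsetPn; exists x; last by case/setDP: nZx.
by rewrite inE Gx; apply/cent1P.
Qed.

(** Both sides, multiplied by #|Z|, are twice the number of noncentral elements: once as a
    difference of orders, once counted axis by axis. *)
Lemma pole_sum :
  2 * (#|G : Z|%:Z - 1) = \sum_(n <- L) (#|G : Z|%:Z - (#|G : Z| %/ n)%N%:Z).
Proof.
have w0 : (#|Z|%:Z : int) != 0 by rewrite -lt0n.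
apply: (mulfI w0).
have := sum_cent1_family (fun=> 1 : int).
have cardM C : C \in M -> \sum_(g in C :\: Z) (1 : int) = #|C|%:Z - #|Z|%:Z.
  move=> /cent1_family_sub sZC; rewrite sumr_const cardsDS //.
  by rewrite natz subzn ?subset_leq_card.
rewrite (eq_bigr _ cardM) !sumr_const => cardG.
have := sumL (fun m => m%:Z - #|Z|%:Z).
rewrite -[\sum_(C in M) _](addKr (1 *+ #|Z|)) -cardG => E.
rewrite mulrCA mulrBr mulr1 -PoszM Lagrange ?rcenter_sub //.
rewrite mulr_natl -[Posz #|G|]natz -[Posz #|Z|]natz addrC E mulr_sumr.
rewrite !big_seq; apply: eq_bigr => n Ln.
have [_ dvn] := pole_order_gt1 Ln.
rewrite -{2}(divnK dvn) natz -mulr_natr natz !PoszM; ring.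
Qed.

(** The eigenvalue map is a bijection from the axis C to the #|C|-th roots of unity. *)
Lemma cent1_family_joukowski C z : C \in M -> non_unity_root z ->
  \sum_(g in C) (joukowski z - \tr (V g))^-1 =
    #|C|%:R * (z ^+ #|C| + 1) / ((z ^+ #|C| - 1) * (z - z^-1)).
Proof.
case/imsetP=> x nZx -> Uz.
have [e [_ eX e_inj e_tr]] := centralizer_eigenvalue fV detV nZx.
pose rs := [seq e g | g <- enum 'C_G[x]].
have <- : \sum_(y <- rs) (joukowski z - joukowski y)^-1 =
          \sum_(g in 'C_G[x]) (joukowski z - \tr (V g))^-1.
  by rewrite big_map big_enum; apply: eq_bigr => g Cg; rewrite (e_tr g Cg).2.
apply: sum_joukowski_unity_roots => //.
- rewrite map_inj_in_uniq ?enum_uniq // => g h; rewrite !mem_enum; exact: e_inj.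
- by rewrite size_map -cardE.
move=> y /mapP[g]; rewrite mem_enum => Cg ->.
by rewrite -(eX g Cg) expg_cardG //; exact: (eX 1%g (group1 _) 0).
Qed.

Lemma molien_pole_series z : ~~ odd #|G| -> non_unity_root z ->
  #|G|%:R^-1 * \sum_(g in G) (joukowski z - \tr (V g))^-1 = pole_series L z.
Proof.
move=> evenG Uz; have [t [Gt Vt defZ cardZ]] := rcenter_even fV detV evenG.
set J := joukowski z; pose E n : F := cyclic_series n z.
have z2 : z ^+ 2 - 1 != 0 by apply: non_unity_rootP.
have z0 := Uz.1.
have sumZ : \sum_(g in Z) (J - \tr (V g))^-1 = 2 * E 1%N.
  have t1 : 1%g != t.
    by apply: contra_eq_neq cardZ => t1; rewrite defZ -t1 setUid cards1.
  rewrite defZ big_setU1 ?inE //= big_set1 repr_mx1 Vt raddfN /= mxtrace1 /J.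
  rewrite /E /cyclic_series /joukowski.
  have zp : z + 1 != 0.
    by apply: contraNneq z2 => zp; rewrite -[1](expr1n _ 2) subr_sqr zp mulr0.
  have zm : z - 1 != 0 by apply: (@non_unity_rootP _ z 1).
  have zz : z * z - 1 != 0 by rewrite -expr2.
  have zp2 : z * z + 1 + 2 * z != 0.
    by rewrite (_ : _ + _ = (z + 1) * (z + 1)) ?mulf_neq0 //; ring.
  have zm2 : z * z + 1 + -2 * z != 0.
    by rewrite (_ : _ + _ = (z - 1) * (z - 1)) ?mulf_neq0 //; ring.
  by field; rewrite z0 zz zp2 zm2.
have sumC C : C \in M -> \sum_(g in C :\: Z) (J - \tr (V g))^-1 =
    #|C|%:R * E (#|C| %/ 2)%N - 2 * E 1%N.
  move=> MC; have sZC := cent1_family_sub MC.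
  have := cent1_family_joukowski MC Uz; rewrite (big_setID Z) /= (setIidPr sZC).
  rewrite sumZ => /(canRL (addKr _)) ->; rewrite addrC; congr (_ - _).
  rewrite -mulrA; congr (_ * _); rewrite /E /cyclic_series mulnC divnK //.
  by case/imsetP: MC => x /setDP[Gx _] ->;
    rewrite -cardZ cardSg // rcenter_sub_cent1.
rewrite sum_cent1_family sumZ (eq_bigr _ sumC).
have nN0 : #|G : Z|%:R != 0 :> F by rewrite pnatr_eq0 -lt0n indexg_gt0.
have := sumL (fun m => m%:R * E (m %/ 2)%N - 2 * E 1%N).
rewrite cardZ mulr2n => E2.
have : \sum_(n <- L) ((2 * n)%:R * E ((2 * n) %/ 2)%N - 2 * E 1%N) *+ (#|G : Z|
  %/ n) =
   2 * #|G : Z|%:R * (\sum_(n <- L) E n)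
   - 2 * E 1%N * ((size L)%:R * #|G : Z|%:R - 2 * (#|G : Z|%:R - 1)).
  (* This is [pole_sum] solved for the sum of the quotients; it fixes the coefficient of [E 1]. *)
  have <- : \sum_(n <- L) (#|G : Z| %/ n)%:R =
            (size L)%:R * #|G : Z|%:R - 2 * (#|G : Z|%:R - 1) :> F.
    have := congr1 (intr : int -> F) pole_sum.
    rewrite sumrB big_const_seq count_predT iter_addr_0 -[_ *+ size L]mulr_natl.
    rewrite rmorphM !rmorphB rmorphM !rmorph_nat rmorph1 rmorph_sum /= -!pmulrn
      => ->.
    by rewrite opprB addrCA subrr addr0; apply: eq_bigr => n _; rewrite -pmulrn.
  rewrite mulr_sumr [2 * E 1%N * _]mulr_sumr -sumrB !big_seq;
    apply: eq_bigr => n Ln.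
  have [_ dvn] := pole_order_gt1 Ln.
  rewrite mulKn // -[_ *+ (_ %/ n)]mulr_natr -{2}(divnK dvn) !natrM; ring.
rewrite -E2 /pole_series -/(E 1%N) => E3.
have <- : (#|Z| * #|G : Z|)%N = #|G| by rewrite Lagrange ?rcenter_sub.
rewrite cardZ natrM; set S := \sum_(C in M) _ in E3 *.
have n20 : (2 : F) != 0 by rewrite pnatr_eq0.
have {E3} -> := canRL (mulfK n20) (etrans (mulr_natr S 2) E3).
by field.
Qed.

End PoleList.
End CentralizerFamily.

(** * Polyhedral groups *)

Section ConjugationOnSets.
Local Open Scope group_scope.

(** H is normal and transpositions are conjugate, so H contains all of them or none. It cannot
    contain all, as they generate the symmetric group; hence membership in H is determined by
    parity. *)
Lemma Alt_index2 (T : finType) (H : {group {perm T}}) :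
  #|'Sym_T : H| = 2%N -> H = 'Alt_T :> {set _}.
Proof.
move=> iH; have sHS : H \subset 'Sym_T by apply: subsetT.
have nHS := normal_norm (index2_normal sHS iH).
have HJ s t : (s ^ t \in H) = (s \in H) by rewrite memJ_norm // (subsetP nHS)
  ?inE.
have notH s t : s \notin H -> (s * t \in H) = (t \notin H).
  move=> nHs; have := rcoset_index2 sHS iH (x := s^-1).
  rewrite !inE groupV nHs => /(_ isT)/setP/(_ t).
  rewrite mem_rcoset invgK !inE andbT => <-.
  by rewrite -(HJ (s * t) s) conjgE !mulgA mulVg mul1g.
have step x y b : x != y -> x != b -> tperm x y \in H -> tperm x b \in H.
  move=> xy xb; rewrite -(HJ _ (tperm y b)) tpermJ tpermL tpermD //.
  - by rewrite eq_sym.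
  by rewrite eq_sym.
have notH_tperm x y : x != y -> tperm x y \notin H.
  move=> xy; apply/negP => Hxy.
  have all_t a b : a != b -> tperm a b \in H.
    move=> ab; have [E | bx] := eqVneq b x.
      by rewrite E tpermC (step x y) // -E eq_sym.
    by rewrite tpermC (step b x) 1?[b == a]eq_sym // tpermC (step x y) //
      eq_sym.
  have sSH : 'Sym_T \subset H.
    apply/subsetP => s _; have [ts -> ts_d] := prod_tpermP s.
    rewrite big_seq group_prod // => t ts_t; apply: all_t.
    exact: (allP ts_d).
  by have := indexg_eq1 'Sym_T H; rewrite iH sSH.
apply/setP => s; rewrite Alt_even; have [ts -> ts_d] := prod_tpermP s.
elim: ts ts_d => [|t ts IHts] /=; first by rewrite big_nil group1 odd_perm1.
case/andP=> dt /IHts IH; rewrite big_cons notH ?notH_tperm // IH odd_permM.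
by rewrite odd_tperm dt.
Qed.

Lemma conj_set_morphism (gT : finGroupType) (G : {group gT}) (S : {set {set
  gT}}) k :
    #|S| = k -> {in G, forall g, {in S, forall C, C :^ g \in S}} ->
  exists f : {morphism G >-> {perm 'I_k}}, forall g,
    (g \in 'ker f) = (g \in G) && [forall C in S, g \in 'N(C)].
Proof.
move=> cardS SJ; pose e (i : 'I_k) : {set gT} := enum_val (cast_ord (esym
  cardS) i).
have e_inj : injective e by move=> i j /enum_val_inj/cast_ord_inj.
have Se i : e i \in S by apply: enum_valP.
have Sr C : C \in S -> {i | e i = C}.
  move=> SC; exists (cast_ord cardS (enum_rank_in SC C)).
  by rewrite /e cast_ordK enum_rankK_in.
pose r C i0 := if [pick i | e i == C] is Some i then i else i0.
have rK C i0 : C \in S -> e (r C i0) = C.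
  move=> SC; rewrite /r; case: pickP => [i /eqP //|]; have [i <-] := Sr C SC.
  by move/(_ i)/eqP.
pose act i g := if g \in G then r (e i :^ g) i else i.
have e_act i g : g \in G -> e (act i g) = e i :^ g.
  by move=> Gg; rewrite /act Gg rK // SJ.
have actP : is_action G act.
  split=> [g i j | i g h Gg Gh].
    have [Gg | nGg] := boolP (g \in G); last by rewrite /act (negPf nGg).
    by move/(congr1 e); rewrite !e_act // => /conjsg_inj/e_inj.
  by apply: e_inj; rewrite !e_act ?groupM // conjsgM.
pose to := Action actP; exists (actperm_morphism to) => g.
rewrite ker_actperm; apply/setIP/andP => [[Gg /[!inE] /subsetP fixg] | [Gg
  /forall_inP nSg]].
  split=> //; apply/forall_inP => C SC; have [i <-] := Sr C SC.
  by apply/normP; rewrite -e_act //; congr e; have /(_ (in_setT i)) := fixg i;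
    rewrite inE => /eqP.
split=> //; rewrite inE; apply/subsetP => i _; rewrite inE; apply/eqP/e_inj;
  rewrite [LHS]e_act //.
exact/normP/nSg.
Qed.

End ConjugationOnSets.

(** * Axes of a given order *)

Section CentralizersOfGivenOrder.
Local Open Scope group_scope.
Variables (F : numClosedFieldType) (gT : finGroupType) (G : {group gT}).
Variable V : mx_representation F G 2.
Hypotheses (fV : mx_faithful V) (detV : {in G, forall g, \det (V g) = 1%R}).
Hypothesis evenG : ~~ odd #|G|.
Local Notation Z := (rcenter V).
Local Notation M := (cent1_family V).

Variables (z : gT) (L : seq nat).
Hypotheses (Gz : z \in G) (Vz : V z = (- 1%:M)%R)
  (LM : {in L, forall n, exists2 C, C \in M & #|C| = (#|Z| * n)%N})
  (ML : {in M, forall C : {set gT}, exists2 n, n \in L & #|C| = (#|Z| * n)%N})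
  (sumL : forall (W : nmodType) (phi : nat -> W),
        ((\sum_(C in M) phi #|C|) *+ 2 =
          \sum_(n <- L) phi (#|Z| * n)%N *+ (#|G : Z| %/ n))%R).

Lemma rcenter_pair : Z = [set 1; z] /\ #|Z| = 2%N.
Proof.
have [t [Gt Vt -> cZ]] := rcenter_even fV detV evenG; split=> //.
by have -> : z = t by apply: (mx_faithful_inj fV); rewrite // Vt Vz.
Qed.

Lemma rcenter_cycle : Z = <[z]>.
Proof.
have [defZ cZ] := rcenter_pair.
have zZ : z \in Z by rewrite defZ set22.
have z1 : z != 1 by apply: contra_eq_neq cZ => z1;
  rewrite defZ z1 setUid cards1.
apply/eqP; rewrite eq_sym eqEcard cycle_subG zZ cZ /=.
by rewrite ltnNge -trivg_card_le1 cycle_eq1.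
Qed.

Lemma cent1_familyE C : C \in M -> exists2 x, x \in G :\: Z & C = 'C_G[x].
Proof. by case/imsetP=> x nZx ->; exists x. Qed.

Definition cent1_family_of n : {set {set gT}} := [set C in M | #|C| == (2 *
  n)%N].

(** The identity on L for the indicator function of the order 2n; the factor 2 is the number of
    poles of an axis. *)
Lemma card_cent1_family_of n :
  (#|cent1_family_of n| * 2 = count_mem n L * (#|G : Z| %/ n))%N.
Proof.
have [_ cZ] := rcenter_pair.
have := @sumL nat (fun m => (m == 2 * n)%N : nat).
have mulrn_nat (a k : nat) : (a *+ k)%R = (a * k)%N.
  by elim: k => [|k IHk]; rewrite ?muln0 // mulrS IHk mulnS.
rewrite cZ mulrn_nat => E.
have -> : #|cent1_family_of n| = (\sum_(C in M) nat_of_bool (#|C| == 2 *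
  n)%N)%R.
  rewrite -sum1_card; under eq_bigl do rewrite inE.
  by rewrite big_mkcondr; apply: eq_bigr => C _; case: eqP.
rewrite E; elim: (L) => [|m s IHs]; first by rewrite big_nil.
rewrite big_cons IHs mulrn_nat eqn_pmul2l //= mulnDl.
by have [-> | _] := eqVneq m n.
Qed.

Lemma cent1_family_ofJ n :
  {in G, forall g, {in cent1_family_of n, forall C, C :^ g \in cent1_family_of
    n}}.
Proof.
move=> g Gg C; rewrite !inE cardJg => /andP[MC ->]; rewrite andbT.
exact: cent1_familyJ.
Qed.

Lemma cent1_family_of_norm n C g : C \in cent1_family_of n -> g \in 'N_G(C) ->
  g \notin C -> g * g = z /\ {in C, forall c, c ^ g = c^-1}.
Proof.
rewrite inE => /andP[/cent1_familyE[x nZx ->] _] Ng nCg.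
split; first exact: (cent1_norm_sqr fV detV evenG nZx Ng nCg Gz Vz).
by move=> c; apply: (cent1_norm_inv fV detV nZx Ng nCg).
Qed.

Lemma cent1_family_of_mem n C c : C \in cent1_family_of n -> c \in C ->
  c \notin Z -> c \in G /\ 'C_G[c] = C.
Proof.
rewrite inE => /andP[MC _] Cc nZc;
  have [/setDP[Gc _] ->] := cent1_familyP fV detV MC Cc nZc.
by [].
Qed.

(* An h in one axis C that fixes another axis satisfies h^2 = z, which has no
   solution in C because #|C| = 2n with n odd.  Hence a noncentral g fixing all
   axes lies on none and inverts each, and then so does c^2 = [g, c] for c in
     C. *)
Lemma cent1_family_of_fix n g : odd n -> (1 < n)%N -> (1 < #|cent1_family_of
  n|)%N ->
  g \in G -> {in cent1_family_of n, forall C, g \in 'N(C)} -> g \in Z.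
Proof.
move=> odd_n n1 S1 Gg nSg.
have [defZ cZ] := rcenter_pair.
have nZz : z != 1 by apply: contra_eq_neq cZ => z1;
  rewrite defZ z1 setUid cards1.
have zz : z * z = 1 by apply: (rcenter_sqr fV detV); rewrite defZ set22.
have claimA h C : h \in G -> {in cent1_family_of n, forall C, h \in 'N(C)} ->
    C \in cent1_family_of n -> h \in C -> h \in Z.
  move=> Gh nSh SC Ch; apply/negPn/negP => nZh.
  have [D SD neDC] : exists2 D, D \in cent1_family_of n & D != C.
    have /card_gt0P[D] : (0 < #|cent1_family_of n :\ C|)%N.
      by move: S1; rewrite (cardsD1 C) SC.
    by case/setD1P => neDC SD; exists D.
  have nDh : h \notin D.
    apply: contra neDC => Dh; have [_ <-] := cent1_family_of_mem SC Ch nZh.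
    by have [_ <-] := cent1_family_of_mem SD Dh nZh.
  have [hh _] : h * h = z /\ {in D, forall c, c ^ h = c^-1}.
    have Nh : h \in 'N_G(D) by apply/setIP; split=> //; apply: nSh.
    exact: (cent1_family_of_norm SD Nh nDh).
  have [x _ defC] : exists2 x, x \in G :\: Z & C = 'C_G[x].
    by apply: cent1_familyE; move: SC; rewrite inE => /andP[].
  have cC : #|C| = (2 * n)%N by move: SC; rewrite inE => /andP[_ /eqP].
  have Cxh : h \in 'C_G[x] by rewrite -defC.
  have : (#[h] %| #|'C_G[x]|)%N := order_dvdG Cxh.
  rewrite -defC cC.
  have h2 : h ^+ 2 = z by rewrite expgS expg1.
  have oh4 : h ^+ (2 * 2)%N = 1 by rewrite expgM h2 expgS expg1.
  rewrite order_dvdn => /eqP oh2n.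
  have : h ^+ (2 * 1)%N = 1.
    apply/eqP; rewrite -order_dvdn -[X in (_ %| X)%N](_ : gcdn (2 * 2) (2 * n)
      = _).
      by rewrite dvdn_gcd !order_dvdn oh4 oh2n eqxx.
    by rewrite -muln_gcdr; congr (_ * _)%N; apply/eqP;
      rewrite -/(coprime _ _) coprime2n.
  by rewrite muln1 h2 => /eqP; rewrite (negPf nZz).
apply/negPn/negP => nZg.
have /card_gt0P[C SC] : (0 < #|cent1_family_of n|)%N by apply: ltn_trans S1.
have nCg : g \notin C by apply: contra nZg; apply: claimA SC.
have [_ invC] : g * g = z /\ {in C, forall c, c ^ g = c^-1}.
  have Ng : g \in 'N_G(C) by apply/setIP; split=> //; apply: nSg.
  exact: (cent1_family_of_norm SC Ng nCg).
have [x nZx defC] : exists2 x, x \in G :\: Z & C = 'C_G[x].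
  by apply: cent1_familyE; move: SC; rewrite inE => /andP[].
have cC : #|C| = (2 * n)%N by move: SC; rewrite inE => /andP[_ /eqP].
have /cyclicP[c defc] := cent1_cyclic fV detV nZx.
have Cc : c \in C by rewrite defC defc cycle_id.
have Gc : c \in G by move: Cc; rewrite defC => /setIP[].
have Ccc : c * c \in C by move: Cc; rewrite defC => Cxc; apply: groupM.
have CcV : c^-1 \in C by move: Cc; rewrite defC groupV.
have c2Z : c * c \in Z.
  apply: (claimA _ C) => //; first by rewrite groupM.
  move=> D SD; have -> : c * c = g^-1 * g ^ c.
    by rewrite -{1}[c]invgK -(invC _ CcV) !conjgE !mulgA.
  have gcD : g ^ c \in 'N(D).
    rewrite -[D](conjsgKV c) normJ memJ_conjg; apply: nSg.
    by apply: cent1_family_ofJ; rewrite ?groupV.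
  by apply: groupM; rewrite ?groupV //; apply: nSg.
(* The generator c of C has a central square, hence order dividing 4, whereas #|C| = 2n is at least
   6. *)
have c4 : (#[c] %| 2 * 2)%N.
  have sqr (u : gT) : u ^+ 2 = u * u by rewrite expgS expg1.
  by rewrite order_dvdn expgM !sqr (rcenter_sqr fV detV c2Z).
have n3 : (2 < n)%N by case: (n) odd_n n1 => [|[|[|]]].
have := @dvdn_leq #[c] (2 * 2)%N isT c4;
  rewrite orderE -defc -defC cC leqNgt => /negP[].
by apply: leq_trans (leq_mul (leqnn 2) n3).
Qed.

End CentralizersOfGivenOrder.

Section PolyhedralQuotients.
Local Open Scope group_scope.
Variables (F : numClosedFieldType) (gT : finGroupType) (G : {group gT}).
Variable V : mx_representation F G 2.
Hypotheses (fV : mx_faithful V) (detV : {in G, forall g, \det (V g) = 1%R}).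
Hypothesis evenG : ~~ odd #|G|.
Local Notation Z := (rcenter V).
Local Notation M := (cent1_family V).

Variables (z : gT) (L : seq nat).
Hypotheses (Gz : z \in G) (Vz : V z = (- 1%:M)%R)
  (LM : {in L, forall n, exists2 C, C \in M & #|C| = (#|Z| * n)%N})
  (ML : {in M, forall C : {set gT}, exists2 n, n \in L & #|C| = (#|Z| * n)%N})
  (sumL : forall (W : nmodType) (phi : nat -> W),
        ((\sum_(C in M) phi #|C|) *+ 2 =
          \sum_(n <- L) phi (#|Z| * n)%N *+ (#|G : Z| %/ n))%R).

Let cardZ : #|Z| = 2%N. Proof. by have [] := rcenter_pair fV detV evenG Gz Vz.
  Qed.
Let Zz : Z = <[z]>. Proof. exact: rcenter_cycle. Qed.

Let cardG : #|G| = (2 * #|G : Z|)%N.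
Proof. by have := Lagrange (@rcenter_sub _ _ _ V); rewrite cardZ => ->. Qed.

Let cardM n := card_cent1_family_of fV detV evenG Gz Vz sumL n.

Lemma cyclic_quotient : #|G : Z| \in L -> cyclic G.
Proof.
case/LM=> C /cent1_familyE[x nZx ->]; rewrite Lagrange ?rcenter_sub // => cardC.
have sCG : 'C_G[x] \subset G by apply: subsetIl.
have /eqP <- : 'C_G[x] == G :> {set gT} by rewrite eqEcard sCG cardC /=.
exact: (cent1_cyclic fV detV nZx).
Qed.

(** An axis of order 2n has index 2, and every element outside it has square z. For a generator c of
    the axis and y outside, the images of c y and y are therefore involutions; they generate the
    quotient, and differ because n > 1. *)
Lemma dihedral_quotient n : n \in L -> (1 < n)%N -> #|G : Z| = (2 * n)%N ->
  G / <[z]> \isog 'D_(2 * n)%N.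
Proof.
case/LM=> C /cent1_familyE[x nZx ->] cardC n1 iG; rewrite cardZ in cardC.
have sCG : 'C_G[x] \subset G by apply: subsetIl.
have iC : #|G : 'C_G[x]| = 2%N.
  by rewrite -divgS // cardC cardG iG mulnK // muln_gt0 /= (ltnW n1).
have nCG := index2_normal sCG iC.
have [y Gy nCy] : exists2 y, y \in G & y \notin 'C_G[x].
  by apply/subsetPn; rewrite -indexg_eq1 iC.
have /cyclicP[c defC] := cent1_cyclic fV detV nZx.
have Cc : c \in 'C_G[x] by rewrite defC cycle_id.
have Gc : c \in G by apply: (subsetP sCG).
have sqz u : u \in G -> u \notin 'C_G[x] -> u * u = z.
  move=> Gu nCu; apply: (cent1_norm_sqr fV detV evenG nZx) => //.
  by rewrite inE Gu (subsetP (normal_norm nCG)).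
have nCcy : c * y \notin 'C_G[x] by rewrite (groupMl _ Cc).
have nzG : G \subset 'N(<[z]>).
  by rewrite -Zz (normal_norm (rcenter_normal V)).
have nZG u : u \in G -> u \in 'N(<[z]>) by apply: (subsetP nzG).
have sZC : <[z]> \subset 'C_G[x].
  by rewrite -Zz rcenter_sub_cent1 //; case/setDP: nZx.
have ord2 u : u \in G -> u \notin 'C_G[x] -> #[coset <[z]> u] = 2%N.
  move=> Gu nCu; apply: nt_prime_order => //.
    by rewrite -morphX ?nZG //= expgS expg1 sqz // coset_id ?cycle_id.
  apply: contra nCu => /eqP/coset_idr u1; apply: (subsetP sZC).
  by apply: u1; apply: nZG.
have defG : <<[set coset <[z]> (c * y); coset <[z]> y]>> = G / <[z]>.
  apply/eqP; rewrite eqEsubset gen_subG; apply/andP; split.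
    by apply/subsetP => _ /set2P[] ->; rewrite mem_quotient ?groupM.
  set W := <<_>>; have Wy : coset <[z]> y \in W by rewrite mem_gen ?set22.
  have Wc : coset <[z]> c \in W.
    have -> : coset <[z]> c = coset <[z]> (c * y) * (coset <[z]> y)^-1.
      by rewrite morphM ?nZG // mulgK.
    by rewrite groupM ?groupV // mem_gen ?set21.
  have WC u : u \in 'C_G[x] -> coset <[z]> u \in W.
    by rewrite defC => /cycleP[k ->]; rewrite morphX ?nZG // groupX.
  apply/subsetP => _ /morphimP[u _ Gu ->].
  have [/WC //|nCu] := boolP (u \in 'C_G[x]).
  have : u \in 'C_G[x] :* y.
    by rewrite (rcoset_index2 sCG iC); apply/setDP.
  case/rcosetP => v Cv ->; have Gv := subsetP sCG v Cv.
  by rewrite morphM ?nZG // groupM // WC.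
have := involutions_gen_dihedral (ord2 _ (groupM Gc Gy) nCcy) (ord2 _ Gy nCy).
have cQ : #|G / <[z]>| = (2 * n)%N by rewrite card_quotient // -iG Zz.
rewrite defG cQ; apply.
apply/eqP; rewrite morphM ?nZG // => /(canRL (mulgK _)); rewrite mulgV.
move/(coset_idr (nZG c Gc)) => zc.
have : (#|'C_G[x]| <= #|Z|)%N by rewrite subset_leq_card // defC Zz cycle_subG.
by rewrite cardC cardZ leqNgt ltn_Pmulr.
Qed.

Lemma rcenter_norm (C : {set gT}) : C \subset G -> z \in 'N(C).
Proof.
move=> sCG; apply: (subsetP (cent_sub C)); apply/centP => c Cc.
by apply: (rcenter_cent fV); rewrite ?(subsetP sCG) // Zz cycle_id.
Qed.

Lemma conj_set_quotient (S : {set {set gT}}) k : #|S| = k ->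
    {in G, forall g, {in S, forall C, C :^ g \in S}} ->
    {in S, forall C : {set gT}, C \subset G} ->
    (forall g, g \in G -> {in S, forall C, g \in 'N(C)} -> g \in Z) ->
  exists f : {morphism G >-> {perm 'I_k}},
    G / <[z]> \isog f @* G /\ #|f @* G| = #|G : Z|.
Proof.
move=> cardS SJ sSG fixZ; have [f kerf] := conj_set_morphism cardS SJ.
have kerZ : 'ker f = <[z]>.
  rewrite -Zz; apply/setP => g; rewrite kerf.
  apply/andP/idP => [[Gg /forall_inP fixg] | Zg]; first exact: fixZ.
  have Gg : g \in G by apply: (subsetP (@rcenter_sub _ _ _ V)).
  split=> //; apply/forall_inP => C SC; rewrite Zz in Zg.
  have /cycleP[i ->] := Zg; rewrite groupX //.
  exact: rcenter_norm (sSG C SC).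
exists f; split; first by rewrite -kerZ; apply: first_isog.
by rewrite card_morphim setIid kerZ Zz.
Qed.

Lemma cent1_family_of_subG n : {in cent1_family_of V n, forall C : {set gT}, C
  \subset G}.
Proof.
move=> C; rewrite inE => /andP[/cent1_familyE[x _ ->] _]; exact: subsetIl.
Qed.

Lemma axes3_quotient : #|cent1_family_of V 3| = 4%N ->
  exists f : {morphism G >-> {perm 'I_4}},
    G / <[z]> \isog f @* G /\ #|f @* G| = #|G : Z|.
Proof.
move=> card3; apply: (conj_set_quotient card3).
- exact: cent1_family_ofJ.
- exact: cent1_family_of_subG.
by move=> g; apply: (cent1_family_of_fix fV detV evenG Gz Vz); rewrite // card3.
Qed.

Lemma tetrahedral_quotient : perm_eq L [:: 2; 3; 3]%N -> #|G : Z| = 12%N ->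
  G / <[z]> \isog 'Alt_('I_4).
Proof.
(* Two orbits of 12 / 3 poles of order 3, that is eight poles on four axes. *)
move=> permL iZ; have card3 : #|cent1_family_of V 3| = 4%N.
  apply/eqP; rewrite -(eqn_pmul2r (isT : 0 < 2)%N) cardM iZ.
  by rewrite (seq.permP permL).
have [f [isof cardf]] := axes3_quotient card3.
have <- // : f @* G = 'Alt_('I_4).
apply: Alt_index2; rewrite -divgS ?subsetT // cardf iZ card_Sym card_ord.
by [].
Qed.

Lemma octahedral_quotient : perm_eq L [:: 2; 3; 4]%N -> #|G : Z| = 24%N ->
  G / <[z]> \isog 'Sym_('I_4).
Proof.
move=> permL iZ; have card3 : #|cent1_family_of V 3| = 4%N.
  apply/eqP; rewrite -(eqn_pmul2r (isT : 0 < 2)%N) cardM iZ.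
  by rewrite (seq.permP permL).
have [f [isof cardf]] := axes3_quotient card3.
have <- // : f @* G = 'Sym_('I_4).
by apply/eqP; rewrite eqEcard subsetT cardf iZ card_Sym card_ord.
Qed.

(** Each axis has two central elements, and its other elements lie on no other axis. *)
Lemma card_cent1_cover (B : {set {set gT}}) (K : {set gT}) :
    B \subset M -> K \subset G -> {in B, forall D : {set gT}, D \subset K} ->
  (\sum_(D in B) (#|D| - 2) = #|[set y in K :\: Z | 'C_G[y] \in B]|)%N.
Proof.
move=> sBM sKG sBK; rewrite -sum1_card (partition_big (fun y => 'C_G[y]) (mem
  B)) /=.
  apply: eq_bigr => D BD; have MD := subsetP sBM D BD.
  rewrite -{1}cardZ -cardsDS ?(cent1_family_sub fV MD) // -sum1_card.
  apply: eq_bigl => y; apply/setDP/andP => [[Dy nZy] | [/setIdP[/setDP[Ky nZy]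
    _] /eqP defD]].
    have [_ defD] := cent1_familyP fV detV MD Dy nZy.
    split; last by rewrite -defD.
    apply/setIdP; split; last by rewrite -defD.
    by apply/setDP; split=> //; apply: subsetP (sBK D BD) y Dy.
  by split=> //; rewrite -defD in_setI (subsetP sKG) // cent1id.
by move=> y /setIdP[].
Qed.

(** * The action on five quaternion subgroups *)

Section Icosahedral.
Hypotheses (permL : perm_eq L [:: 2; 3; 5]%N) (iZ : #|G : Z| = 60%N).
Local Notation M2 := (cent1_family_of V 2).

Let oG : #|G| = 120%N. Proof. by rewrite cardG iZ. Qed.

Let card2 : #|M2| = 15%N.
Proof.
apply/eqP; rewrite -(eqn_pmul2r (isT : 0 < 2)%N) cardM iZ.
by rewrite (seq.permP permL).
Qed.

Let M2_P C : C \in M2 -> exists x, [/\ x \in G :\: Z, C = 'C_G[x] & #|C| = 4%N].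
Proof. by rewrite inE => /andP[/cent1_familyE[x nZx ->] /eqP]; exists x. Qed.

Let M2_orbit C : C \in M2 -> orbit 'Js G C \subset M2.
Proof.
move=> C2; apply/subsetP => _ /orbitP[g Gg <-]; exact: cent1_family_ofJ.
Qed.

Let card_orbit_norm (C : {set gT}) : (#|orbit 'Js G C| * #|'N_G(C)| = 120)%N.
Proof. by rewrite card_orbit astab1Js mulnC Lagrange ?subsetIl. Qed.

(** A normaliser of order 4 would give an orbit of 30 axes, but there are only 15. *)
Let norm8 C : C \in M2 -> #|'N_G(C)| = 8%N.
Proof.
move=> C2; have [x [nZx defC cC]] := M2_P C2.
have sCN : 'C_G[x] \subset 'N_G('C_G[x]) by rewrite subsetI subsetIl normG.
have oN : #|'N_G(C)| = (4 * #|'N_G(C) : C|)%N by rewrite -cC defC Lagrange.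
have := card_orbit_norm C; have := subset_leq_card (M2_orbit C2).
rewrite card2 oN => le15; have := cent1_index fV detV nZx; rewrite -defC.
case=> -> // /eqP; rewrite -[120%N]/(30 * (4 * 1))%N eqn_pmul2r // => /eqP E.
by rewrite E in le15.
Qed.

Let orbit_M2 C : C \in M2 -> orbit 'Js G C = M2.
Proof.
move=> C2; apply/eqP; rewrite eqEcard M2_orbit // card2.
have /eqP := card_orbit_norm C;
  rewrite norm8 // -[120%N]/(15 * 8)%N eqn_pmul2r //.
by move/eqP->.
Qed.

(** Outside C, y has square z and order 4. Among the axis orders 4, 6, 10 only 4 is divisible by 4,
    so the axis of y is <[y]>; it has index 2 in 'N_G(C), hence is normal there, and both
    normalisers have order 8. *)
Let norm_mem C y : C \in M2 -> y \in 'N_G(C) -> y \notin Z ->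
  'C_G[y] \in M2 /\ 'N_G('C_G[y]) = 'N_G(C).
Proof.
move=> C2 Ny nZy; have [Cy | nCy] := boolP (y \in C).
  by have [_ ->] := cent1_family_of_mem fV detV C2 Cy nZy.
have [yy _] := cent1_family_of_norm fV detV evenG Gz Vz C2 Ny nCy.
have Gy : y \in G by case/setIP: Ny.
have nZGy : y \in G :\: Z by apply/setDP.
have MD : 'C_G[y] \in M by apply: imset_f.
have z1 : z != 1.
  by apply: contra_eq_neq cardZ => z1; rewrite Zz z1 cycle1 cards1.
have Dy : y \in 'C_G[y] by rewrite in_setI Gy cent1id.
have y2 : y ^+ 2 = z by rewrite expgS expg1.
have oy : #[y] = 4%N.
  have z2 : z ^+ 2 = 1.
    by rewrite expgS expg1 (rcenter_sqr fV detV) // Zz cycle_id.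
  by rewrite (@orderXprime _ 2 2 y) // y2; apply: nt_prime_order.
have D2 : 'C_G[y] \in M2.
  rewrite inE MD /=; have [n] := ML MD; rewrite (perm_mem permL) !inE cardZ.
  have : (#[y] %| #|'C_G[y]|)%N by apply: order_dvdG.
  move=> dv n_ E; rewrite E oy in dv; rewrite E.
  by case/or3P: n_ => /eqP En; rewrite En in dv *.
split=> //; have sDN : 'C_G[y] \subset 'N_G(C).
  have /eqP <- : <[y]> == 'C_G[y].
    by rewrite eqEcard cycle_subG Dy -orderE oy; have [x [_ _ ->]] := M2_P D2.
  by rewrite cycle_subG.
apply/eqP; rewrite eq_sym eqEcard !norm8 // andbT subsetI subsetIl /=.
apply: normal_norm; apply: index2_normal => //.
by rewrite -divgS // norm8 //; have [x [_ _ ->]] := M2_P D2.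
Qed.

(* The Sylow 2-subgroups of G, which are quaternion groups of order 8. *)
Let klein_set : {set {set gT}} := [set 'N_G(C) | C : {set gT} in M2].

(** The six noncentral elements of T fall into axes of order 4, each with two noncentral
    elements. *)
Let card_klein_fibre T : T \in klein_set ->
  #|[set D in M2 | 'N_G(D) == T]| = 3%N.
Proof.
case/imsetP=> C C2 ->; set B := [set _ in _ | _].
have sBM : B \subset M by apply/subsetP => D; rewrite !inE => /andP[/andP[]].
have BP D : D \in B -> D \in M2 /\ 'N_G(D) = 'N_G(C).
  by rewrite inE => /andP[D2 /eqP].
have sBN : {in B, forall D : {set gT}, D \subset 'N_G(C)}.
  move=> D /BP[D2 <-]; have [x [_ -> _]] := M2_P D2.
  by rewrite subsetI subsetIl normG.
have := card_cent1_cover sBM (subsetIl _ _) sBN.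
have -> : [set y in 'N_G(C) :\: Z | 'C_G[y] \in B] = 'N_G(C) :\: Z.
  apply/setP => y; apply/setIdP/idP => [[] // | NZy]; split=> //.
  case/setDP: NZy => Ny nZy; have [D2 eN] := norm_mem C2 Ny nZy.
  by rewrite inE D2 eN eqxx.
rewrite (eq_bigr (fun=> 2%N)) => [|D /BP[D2 _]]; last first.
  by have [x [_ _ ->]] := M2_P D2.
have sZN : Z \subset 'N_G(C).
  have [x [/setDP[Gx _] -> _]] := M2_P C2.
  by rewrite (subset_trans (rcenter_sub_cent1 fV Gx)) // subsetI subsetIl normG.
rewrite sum_nat_const cardsDS // norm8 // cardZ => /eqP.
by rewrite -[(8 - 2)%N]/(3 * 2)%N eqn_pmul2r // => /eqP.
Qed.

Let card_klein : #|klein_set| = 5%N.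
Proof.
apply/eqP; rewrite -(eqn_pmul2r (isT : 0 < 3)%N) -[(5 * 3)%N]/15%N -card2.
rewrite -sum_nat_const -[X in _ == X]sum1_card.
rewrite [X in _ == X](partition_big (fun C : {set gT} => 'N_G(C)) (mem
  klein_set)) /=; last first.
  by move=> C C2; apply: imset_f.
apply/eqP/eq_bigr => T /card_klein_fibre <-; rewrite -sum1_card.
by apply: eq_bigl => D; rewrite inE.
Qed.

Let norm_conj (C : {set gT}) g : g \in G -> 'N_G(C) :^ g = 'N_G(C :^ g).
Proof. by move=> Gg; rewrite conjIg conjGid // normJ. Qed.

Let kleinJ : {in G, forall g, {in klein_set, forall T, T :^ g \in klein_set}}.
Proof.
move=> g Gg _ /imsetP[C C2 ->]; rewrite norm_conj //; apply: imset_f.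
exact: cent1_family_ofJ.
Qed.

Let norm24 T : T \in klein_set -> #|'N_G(T)| = 24%N.
Proof.
case/imsetP=> C C2 defT; have := card_orbit_norm T.
have -> : orbit 'Js G T = klein_set.
  apply/setP => U; apply/orbitP/imsetP => [[g Gg <-] | [D D2 ->]].
    exists (C :^ g); first exact: cent1_family_ofJ.
    by rewrite defT; apply: norm_conj.
  have : D \in orbit 'Js G C by rewrite orbit_M2.
  by case/orbitP => g Gg <-; exists g; rewrite ?defT //; apply: norm_conj.
rewrite card_klein => /eqP; rewrite -[120%N]/(5 * 24)%N eqn_pmul2l //.
by move/eqP.
Qed.

(** If the kernel had a noncentral element, it would contain its whole axis, of order 2p with p
    prime, and all conjugates of it. These number at least 120 / 4p, so they have at least 60 - 60/p
    >= 30 noncentral elements; but the kernel lies in a normaliser of order 24, which leaves room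
    for 22. *)
Let klein_fix g : g \in G -> {in klein_set, forall T, g \in 'N(T)} -> g \in Z.
Proof.
have [f kerf] := conj_set_morphism card_klein kleinJ.
move=> Gg fixg; have Kg : g \in 'ker f by rewrite kerf Gg; apply/forall_inP.
apply/negPn/negP => nZg; set C := 'C_G[g].
have nZGg : g \in G :\: Z by apply/setDP.
have MC : C \in M by apply: imset_f.
have sZK : Z \subset 'ker f.
  apply/subsetP => u Zu; rewrite kerf (subsetP (@rcenter_sub _ _ _ V)) //=.
  apply/forall_inP => T /imsetP[D _ ->].
  rewrite Zz in Zu; case/cycleP: Zu => i ->; rewrite groupX //.
  exact/rcenter_norm/subsetIl.
have sZC : Z \subset C by apply: rcenter_sub_cent1.
have [p Lp oC] := ML MC.
have pr_p : prime p.
  by move: Lp; rewrite (perm_mem permL) !inE => /or3P[] /eqP->.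
have sCK : C \subset 'ker f.
  have iCZ : #|C : Z| = p.
    by apply/eqP; rewrite -(eqn_pmul2l (cardG_gt0 (rcenter_group V))) Lagrange
      ?oC.
  have sZCK : Z \subset C :&: 'ker f by rewrite subsetI sZC.
  have dvp : (#|C :&: 'ker f : Z| %| p)%N.
    by rewrite -iCZ -(Lagrange_index (subsetIl C ('ker f)) sZCK) dvdn_mull.
  move: dvp; case/primeP: pr_p => _ pr_p /pr_p /orP[].
    rewrite indexg_eq1 => /subsetP sub; case/negP: nZg; apply: sub.
    by rewrite inE Kg andbT in_setI Gg cent1id.
  move=> /eqP iCK; apply/setIidPl/eqP; rewrite eqEcard subsetIl /=.
  by rewrite -(Lagrange sZC) -(Lagrange sZCK) iCK iCZ.
pose B := orbit 'Js G C.
have sBM : B \subset M.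
  by apply/subsetP => _ /orbitP[h Gh <-]; apply: cent1_familyJ.
have sBK : {in B, forall D : {set gT}, D \subset 'ker f}.
  move=> _ /orbitP[h Gh <-]; rewrite /= -(normP (subsetP (ker_norm f) h Gh)).
  by rewrite conjSg.
have sKG : 'ker f \subset G by apply: subsetIl.
have := card_cent1_cover sBM sKG sBK.
have /card_gt0P[T KT] : (0 < #|klein_set|)%N by rewrite card_klein.
have leK : (#|'ker f :\: Z| <= 22)%N.
  rewrite cardsDS // cardZ leq_subLR -[(2 + 22)%N]/24%N -(norm24 KT)
    subset_leq_card //.
  by apply/subsetP => h; rewrite kerf inE => /andP[-> /forall_inP]; apply.
rewrite (eq_bigr (fun=> (2 * p - 2)%N)) => [E | D /orbitP[h _ <-]]; last first.
  by rewrite cardJg oC cardZ.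
have {E} : (#|B| * (2 * p - 2) <= 22)%N.
  rewrite -sum_nat_const E; apply: leq_trans leK.
  by rewrite subset_leq_card //; apply/subsetP => y /setIdP[].
have : (120 <= #|B| * (4 * p))%N.
  rewrite -(card_orbit_norm C) leq_mul2l; apply/orP; right.
  have sCN : C \subset 'N_G(C) by rewrite subsetI subsetIl normG.
  rewrite -(Lagrange sCN) oC cardZ -mulnA [X in (_ <= X)%N](_ : _ = 2 * (p *
    2))%N.
    by rewrite leq_mul2l leq_mul2l; case: (cent1_index fV detV nZGg) => ->;
      rewrite orbT.
  by rewrite mulnC mulnA [(2 * p)%N]mulnC -mulnA.
move: Lp; rewrite (perm_mem permL) !inE; clear; move: #|B| => b.
by case/or3P => /eqP->; lia.
Qed.

Lemma icosahedral_quotient : G / <[z]> \isog 'Alt_('I_5).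
Proof.
have [||f [isof cardf]] := conj_set_quotient card_klein kleinJ.
- by move=> _ /imsetP[C _ ->]; apply: subsetIl.
- exact: klein_fix.
have <- // : f @* G = 'Alt_('I_5).
apply: Alt_index2; rewrite -divgS ?subsetT // cardf iZ card_Sym card_ord.
by [].
Qed.

End Icosahedral.

End PolyhedralQuotients.

(** * The Poincare series *)

Section MolienSeries.
Variables (R : realType) (gT : finGroupType) (G : {group gT}).
Variables (V : mx_representation R[i] G 2) (Gamma : {set gT}).
Hypotheses (fV : mx_faithful V) (detV : {in G, forall g, \det (V g) = 1}).
Hypothesis trG : is_transversal Gamma (classes G) G.
Local Notation f g := (1 - \tr (V g) *: 'X : {poly R[i]}).

(** The trace is J e for a root of unity e, which is 1 or -1 when g is central. *)
Lemma joukowski_sub_trace_neq0 z g : non_unity_root z -> g \in G ->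
  joukowski z - \tr (V g) != 0.
Proof.
move=> Uz Gg; have [e [k e0 [ek ->]]] : exists e : R[i], exists2 k,
    e != 0 & e ^+ k.+1 = 1 /\ \tr (V g) = joukowski e.
  have [Zg | nZg] := boolP (g \in rcenter V).
    have [_ [a Va]] := rcenterP _ _ Zg; have := detV Gg.
    rewrite Va det_scalar => aa; exists a; exists 1%N => //.
      by apply: contra_eq_neq aa => ->; rewrite expr0n eq_sym oner_neq0.
    split=> //; rewrite mxtrace_scalar mulr2n; congr (_ + _).
    by rewrite -[RHS]mul1r -aa expr2 mulfK //; apply: contra_eq_neq aa => ->;
      rewrite expr0n eq_sym oner_neq0.
  have nZGg : g \in G :\: rcenter V by apply/setDP.
  have [e [_ eX _ e_tr]] := centralizer_eigenvalue fV detV nZGg.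
  have Cg : g \in 'C_G[g] by rewrite in_setI Gg cent1id.
  exists (e g); exists #[g].-1; first exact: (e_tr g Cg).1.
  rewrite prednK ?order_gt0 // -(eX g Cg) expg_order (e_tr g Cg).2.
  have -> // : e 1%g = 1 by exact: (eX 1%g (group1 _) 0).
have [z0 zk] := Uz; rewrite joukowskiB // !mulf_neq0 ?invr_eq0 // subr_eq0.
  by apply: contraNneq (zk k) => ->; rewrite ek.
by apply: contraNneq (zk k) => ->; rewrite exprVn ek invr1.
Qed.

Lemma joukowski_neq0 (F : fieldType) (z : F) : non_unity_root z -> joukowski z
  != 0.
Proof.
move=> Uz; have [z0 _] := Uz; apply: contraNneq (@non_unity_rootP _ z 4 Uz isT).
move=> J0; have zz : z * z = -1.
  have := congr1 ( *%R z) J0; rewrite mulrDr mulfV // mulr0.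
  by move/(canRL (addrK _)); rewrite add0r.
by rewrite -[4%N]/(2 * 2)%N exprM !expr2 zz mulrNN mulr1 subrr.
Qed.

(** The condition on the sizes matches powers of J z: at t = 1 / J z the mean of the 1 / (1 - chi(g)
    t) is J z times that of the 1 / (J z - chi(g)). *)
Lemma fps_div_exponents L ms ms' h h' :
    size ms' = (size ms).+1 ->
    (forall z : R[i], non_unity_root z ->
      #|G|%:R^-1 * \sum_(g in G) (joukowski z - \tr (V g))^-1 = pole_series L
        z) ->
    (forall z : R[i], non_unity_root z ->
      exponent_prod ms' h' z * pole_series L z = exponent_prod ms h z) ->
  fps_div (det1X (finite_graph V)) (\prod_(g in Gamma) f g) =1
    fps_div (exponent_poly R ms h) (exponent_poly R ms' h').
Proof.
move=> sz_ms molien eq_exp; have F0 := @pchar_num R[i].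
apply: fps_div_cross; rewrite ?exponent_poly_coef0 ?oner_neq0 //.
  by rewrite -(det1X_repr_graph F0 V trG) det1X_coef0_neq0.
apply: poly_eq_joukowski => z Uz; have J0 := joukowski_neq0 Uz.
rewrite !hornerM !horner_exponent_poly // sz_ms -eq_exp // -molien //.
set J := joukowski z in J0 *; set W := (\prod_(g in Gamma) f g).[J^-1].
have fJ g : (f g).[J^-1] = (J - \tr (V g)) / J.
  by rewrite hornerD hornerN hornerZ hornerX hornerC mulrBl mulfV.
have fJ0 g : g \in G -> (J - \tr (V g)) / J != 0.
  by move=> Gg; rewrite mulf_neq0 ?invr_eq0 ?joukowski_sub_trace_neq0.
have -> : (det1X (finite_graph V)).[J^-1] =
    W * (#|G|%:R^-1 * (J * \sum_(g in G) (J - \tr (V g))^-1)).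
  rewrite (det1X_finite_graph F0 V trG) horner_sum.
  rewrite (sum_transversal trG) => [|a b Ga Gb]; last by rewrite mxtrace_conj.
  rewrite !mulr_sumr; apply: eq_bigr => g Gg.
  have GGg : g \in G by apply: subsetP (transversal_sub trG) g Gg.
  rewrite hornerZ /W (bigD1 g Gg) /= hornerM fJ.
  have := fJ0 g GGg; move: ((\prod_(i in Gamma | i != g) f i).[J^-1]) => P.
  rewrite mulf_eq0 invr_eq0 (negPf J0) orbF => nz.
  by move: (#|G|%:R^-1 : R[i]) (#|g ^: G|%:R : R[i]) => u v; field;
    rewrite J0 nz.
have := expf_neq0 (size ms) J0; rewrite [J ^+ _.+1]exprS;
  move: (J ^+ size ms) => Jk Jk0.
move: (exponent_prod _ _ _) (#|G|%:R^-1 : R[i]) (\sum_(g in G) _) => E u S.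
clearbody W J.
by field; rewrite J0 Jk0.
Qed.

End MolienSeries.

Section FiniteSubgroupsOfSL2.
Variables (R : realType) (gT : finGroupType) (G : {group gT}).
Variables (V : mx_representation R[i] G 2).
Hypotheses (fV : mx_faithful V) (detV : {in G, forall g, \det (V g) = 1}).
Hypothesis ncG : ~ (cyclic G /\ odd #|G|).
Local Notation Z := (rcenter V).
Local Notation M := (cent1_family V).

Variable L : seq nat.
Hypotheses
  (LM : {in L, forall n, exists2 C, C \in M & #|C| = (#|Z| * n)%N})
  (ML : {in M, forall C : {set gT}, exists2 n, n \in L & #|C| = (#|Z| * n)%N})
  (sumL : forall (W : nmodType) (phi : nat -> W),
        (\sum_(C in M) phi #|C|) *+ 2 =
          \sum_(n <- L) phi (#|Z| * n)%N *+ (#|G : Z| %/ n)).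

Let poles := pole_orders_classification (indexg_gt0 G (rcenter_group V))
  (introT allP (fun n Ln => introT andP (pole_order_gt1 fV LM Ln)))
  (pole_sum fV detV LM sumL).

(** The classification gives an even index of the center except in its first two cases. There an odd
    order makes G trivial, respectively G is cyclic, against the hypothesis. *)
Lemma non_cyclic_odd_even : ~~ odd #|G|.
Proof.
apply/negP => oddG; apply: ncG; split=> //.
have odd_iZ : odd #|G : Z|.
  by apply: dvdn_odd oddG; rewrite -(Lagrange (@rcenter_sub _ _ _ V)) dvdn_mull.
case: poles => [iZ | permL | [n iZ _] | [[iZ _]|[iZ _]|[iZ _]]];
  try by rewrite iZ ?mul2n ?odd_double in odd_iZ.
- have sGZ : G \subset Z by rewrite -indexg_eq1 iZ.
  suff -> : G :=: 1%g by apply: cyclic1.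
  apply/trivgP/subsetP => c Gc; rewrite inE -order_eq1.
  have : coprime #[c] 2 by rewrite coprimen2 (dvdn_odd (order_dvdG Gc)).
  rewrite /coprime (gcdn_idPl _) // order_dvdn expgS expg1.
  by rewrite (rcenter_sqr fV detV) // (subsetP sGZ).
by apply: (cyclic_quotient fV detV LM); rewrite (perm_mem permL) mem_head.
Qed.

Let evenG := non_cyclic_odd_even.

Lemma pole_series_perm (L' : seq nat) (z : R[i]) :
  perm_eq L L' -> pole_series L z = pole_series L' z.
Proof. by move=> pL; rewrite /pole_series (perm_big _ pL) (perm_size pL). Qed.

Lemma mckay_classification : exists X : dynkin, mckay_type V X /\
  (size (aff_exponents X) = (size (fin_exponents X)).+1 /\
   forall z : R[i], non_unity_root z ->
     exponent_prod (aff_exponents X) (aff_coxeter X) z * pole_series L z =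
     exponent_prod (fin_exponents X) (fin_coxeter X) z).
Proof.
have [z [Gz Vz _ cZ]] := rcenter_even fV detV evenG.
have cG : #|G| = (2 * #|G : Z|)%N.
  by have := Lagrange (@rcenter_sub _ _ _ V); rewrite cZ => ->.
have typeA n : (0 < n)%N -> #|G : Z| = n -> cyclic G ->
    (forall y : R[i], pole_series L y = pole_series [:: n; n] y) ->
    let X := DynkinA (2 * n).-1 in mckay_type V X /\
  (size (aff_exponents X) = (size (fin_exponents X)).+1 /\
   forall z : R[i], non_unity_root z ->
     exponent_prod (aff_exponents X) (aff_coxeter X) z * pole_series L z =
     exponent_prod (fin_exponents X) (fin_coxeter X) z).
  move=> n0 iZ cycG sumE X; split; first by rewrite /= cG iZ prednK ?muln_gt0.
  split=> [|y Uy]; last by rewrite sumE; apply: mckay_identityA.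
  rewrite /X /= !size_cat !size_iota /=; lia.
have [iZ | permL | [n iZ permL] | [[iZ permL]|[iZ permL]|[iZ permL]]] := poles.
(* Here G = {1, -1} has no axes; the empty list gives the same series as [:: 1; 1], namely
   [cyclic_series 1]. *)
- exists (DynkinA 1); apply: (typeA 1%N) => //.
    by apply: prime_cyclic; rewrite cG iZ.
  have -> : L = [::].
    have notL n : n \notin L.
      apply/negP => /(pole_order_gt1 fV LM)[n1]; rewrite iZ dvdn1 => /eqP E.
      by rewrite E in n1.
    by case: (L) notL => // m L' /(_ m); rewrite mem_head.
  move=> y; rewrite pole_series_cyclic /pole_series big_nil /= !sub0r mulNr
    opprK.
  by rewrite mulrA mulVf ?mul1r // pnatr_eq0.
- exists (DynkinA (2 * #|G : Z|).-1); apply: typeA => //.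
    by apply: (cyclic_quotient fV detV LM); rewrite (perm_mem permL) mem_head.
  by move=> y; apply: pole_series_perm.
- have Ln : n \in L by rewrite (perm_mem permL) !inE eqxx !orbT.
  have [n1 _] := pole_order_gt1 fV LM Ln.
  exists (DynkinD n.+2); split.
    split=> //; exists z; split=> //; rewrite -[(n.+2 - 2)%N]/(n - 0)%N subn0.
    exact: (dihedral_quotient fV detV evenG Gz Vz LM).
  split=> [|y Uy]; last by rewrite (pole_series_perm _ permL) mckay_identityD.
  rewrite /aff_exponents /fin_exponents size_rcons size_map size_iota.
  by case: ifP => odd_n; rewrite size_cat ?size_map size_iota /= in odd_n *;
    lia.
- exists DynkinE6; split.
    by exists z; split=> //; apply: (tetrahedral_quotient fV detV evenG Gz Vz
      sumL).
  by split=> // y Uy; rewrite (pole_series_perm _ permL) mckay_identityE6.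
- exists DynkinE7; split.
    by exists z; split=> //; apply: (octahedral_quotient fV detV evenG Gz Vz
      sumL).
  by split=> // y Uy; rewrite (pole_series_perm _ permL) mckay_identityE7.
exists DynkinE8; split.
  by exists z; split=> //; apply: (icosahedral_quotient fV detV evenG Gz Vz ML
    sumL).
by split=> // y Uy; rewrite (pole_series_perm _ permL) mckay_identityE8.
Qed.

End FiniteSubgroupsOfSL2.

Theorem theorem3p6 (R : realType) (gT : finGroupType) (G : {group gT})
    (V : mx_representation R[i] G 2) (Gamma : {set gT}) :
  SU2_subgroup V ->
  ~ (cyclic G /\ odd #|G|) ->
  is_transversal Gamma (classes G) G ->
  let A := repr_graph V in
  let A0 := finite_graph V in
  let class_poly := \prod_(g in Gamma) (1 - \tr (V g) *: 'X) in
  [/\ poincare_series V =1 fps_div (det1X A0) (det1X A),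
      fps_div (det1X A0) (det1X A) =1 fps_div (det1X A0) class_poly &
      exists X : dynkin, mckay_type V X /\
        fps_div (det1X A0) class_poly =1
          fps_div (exponent_poly R (fin_exponents X) (fin_coxeter X))
                  (exponent_poly R (aff_exponents X) (aff_coxeter X))].
Proof.
move=> [fV SUV] ncG trG A A0 class_poly; have F0 := @pchar_num R[i].
have detV : {in G, forall g, \det (V g) = 1} by move=> g /SUV[].
have [L [LM ML sumL]] := pole_list fV detV.
split; first exact: (poincare_series_det F0 V trG).
  by rewrite /A (det1X_repr_graph F0 V trG).
have [X [typeX [sizeX eqX]]] := mckay_classification fV detV ncG LM ML sumL.
exists X; split=> //; apply: (fps_div_exponents fV detV trG sizeX) eqX.
by move=> z; apply: (molien_pole_series fV detV LM sumL (non_cyclic_odd_even fV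
  detV ncG LM sumL)).
Qed.
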